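(* Let $G$ be a non-empty finite simple graph without isolated vertices. If every non-empty induced subgraph $H$ of $G$ has a vertex $x$ with $\operatorname{reg}(I(H\setminus N_H[x]))+1\le\operatorname{reg}(I(H))$, then for all $q\ge1$, $$\operatorname{reg}(I(G)^q)\le 2q+\operatorname{reg}(I(G))-2.$$
   Context: Graphs are finite and simple. For a graph $G$ on vertex set $\{x_1,\dots,x_n\}$ and a field $\mathbb{K}$, the edge ideal is $I(G)=(x_ix_j \mid \{x_i,x_j\}\in E(G))\subset\mathbb{K}[x_1,\dots,x_n]$ (standard grading), and $\operatorname{reg}(-)$ is the Castelnuovo-Mumford regularity. $N_H(x)$ is the set of neighbours of $x$ in $H$, $N_H[x]=N_H(x)\cup\{x\}$, and $H\setminus U$ is the induced subgraph on $V(H)\setminus U$. Conventions: ''non-empty'' means having at least one edge, and for a graph without edges (possibly with no vertices) $\operatorname{reg}(I)=\operatorname{reg}(0)=1$. *)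

(* Defs.v *)
From mathcomp Require Import all_boot all_order all_algebra.
From mathcomp Require Import mpoly.
From Stdlib Require Import ClassicalEpsilon.

Set Implicit Arguments.
Unset Strict Implicit.
Unset Printing Implicit Defensive.

Import GRing.Theory.
Local Open Scope ring_scope.

Record sgraph : Type := SGraph {
  vertex :> finType;
  edge : rel vertex;
  edge_sym : ssrbool.symmetric edge;
  edge_irrefl : irreflexive edge
}.

Definition nonempty (G : sgraph) : Prop := exists u v : G, edge u v.

Definition no_isolated (G : sgraph) : Prop :=
  forall u : G, exists v : G, edge u v.

Definition nbhd (G : sgraph) (x : G) : {set G} := [set y | edge x y].
Definition cnbhd (G : sgraph) (x : G) : {set G} := x |: nbhd x.

Section Induced.
Variables (G : sgraph) (A : {set G}).

Definition induced_vertex : finType := {x : G | x \in A}.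
Definition induced_edge : rel induced_vertex :=
  fun u v => edge (val u) (val v).

Lemma induced_edge_sym : ssrbool.symmetric induced_edge.
Proof. by move=> u v; rewrite /induced_edge edge_sym. Qed.

Lemma induced_edge_irrefl : irreflexive induced_edge.
Proof. by move=> u; rewrite /induced_edge edge_irrefl. Qed.

Definition induced : sgraph := SGraph induced_edge_sym induced_edge_irrefl.

End Induced.

Definition delete (G : sgraph) (U : {set G}) : sgraph := induced (~: U).

Section Ideals.
Variable R : comNzRingType.

Definition ideal_gen (X : R -> Prop) (p : R) : Prop :=
  exists (m : nat) (c g : 'I_m -> R),
    (forall i, X (g i)) /\ p = \sum_(i < m) c i * g i.

Definition ideal_pow (I : R -> Prop) (q : nat) : R -> Prop :=
  ideal_gen (fun p => exists f : 'I_q -> R,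
    (forall i, I (f i)) /\ p = \prod_(i < q) f i).

End Ideals.

(* The variable attached to the vertex u is 'X_(enum_rank u), so that the      *)
(* ambient polynomial ring has exactly the vertices of G as variables.         *)
Definition edge_ideal (K : fieldType) (G : sgraph) : {mpoly K[#|G|]} -> Prop :=
  ideal_gen (fun p => exists u v : G,
    edge u v /\ p = 'X_(enum_rank u) * 'X_(enum_rank v)).
Arguments edge_ideal K G _ : clear implicits.

Section Regularity.
Variables (K : fieldType) (n : nat).
Local Notation S := {mpoly K[n]}.

(* A graded free resolution ... -> F_1 -> F_0 -> I -> 0 by finitely generated  *)
(* free modules F_i = \bigoplus_(k < rk i) S(- shift i k).  Elements of F_i    *)
(* are row vectors and the maps act by multiplication on the right, so row k   *)
(* of diff i is the image in F_i of the k-th basis element of F_(i+1).  Only   *)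
(* natural-number shifts are considered: every basis element of a minimal      *)
(* resolution of an ideal has nonnegative degree.                              *)
Record graded_free_resolution (I : S -> Prop) : Type := GradedFreeResolution {
  rk : nat -> nat;
  shift : forall i, 'I_(rk i) -> nat;
  aug : 'cV[S]_(rk 0);
  diff : forall i, 'M[S]_(rk i.+1, rk i);
  aug_homog : forall k, aug k 0 \is (shift k).-homog;
  diff_homog : forall i (k : 'I_(rk i.+1)) (l : 'I_(rk i)),
    diff i k l = 0 \/
    exists2 e, shift k = (shift l + e)%N & diff i k l \is e.-homog;
  aug_image : forall p, I p <-> exists v : 'rV[S]_(rk 0), p = (v *m aug) 0 0;
  exact_aug : forall v : 'rV[S]_(rk 0),
    v *m aug = 0 <-> exists w : 'rV[S]_(rk 1), v = w *m diff 0;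
  exact_diff : forall i (v : 'rV[S]_(rk i.+1)),
    v *m diff i = 0 <-> exists w : 'rV[S]_(rk i.+2), v = w *m diff i.+1
}.

(* F_(i+1) is mapped into (x_1, ..., x_n) F_i: the entries of the differentials *)
(* have no constant term.                                                      *)
Definition minimal_resolution (I : S -> Prop) (F : graded_free_resolution I) :
    Prop :=
  forall i (k : 'I_(rk F i.+1)) (l : 'I_(rk F i)), (diff F i k l)@_0%MM = 0.

(* r is the maximum of j - i over all i, j such that S(-j) is a direct summand *)
(* of the i-th module of a minimal graded free resolution of I.                *)
Definition is_regularity (I : S -> Prop) (r : nat) : Prop :=
  exists F : graded_free_resolution I,
    [/\ minimal_resolution F,
        forall i (k : 'I_(rk F i)), (shift k <= r + i)%N
      & exists i (k : 'I_(rk F i)), shift k = (r + i)%N].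

(* The zero ideal, whose minimal resolution has no generators at all, has      *)
(* regularity 1 by convention.  The regularity of a nonzero homogeneous ideal  *)
(* exists and is unique, so that epsilon picks no arbitrary value for it.      *)
Definition reg (I : S -> Prop) : nat :=
  if excluded_middle_informative (forall p, I p -> p = 0) then 1%N
  else epsilon (inhabits 0%N) (is_regularity I).

End Regularity.

(* Main.v *)
(* For a monomial ideal J and a variable y, reg J <= max (reg (J : y) + 1,       *)
(* reg (J + (y))), and adding variables to J does not increase its regularity.  *)
(* One bounds more generally reg (I^(k+d) : M) <= 2d + reg I - 2 for every      *)
(* product M of k edges.  Let x be the special vertex of G.  A factorisation of *)
(* u x M into edges can be rerouted along alternating paths through M: either x *)
(* is not needed, or some variable z of u makes z x M a product of k + 1 edges. *)
(* Colons by such z are again colons by products of edges; once all those z are *)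
(* set to zero, only edges of G \ N[x] remain, where the regularity drops.      *)
(* Minimal free resolutions enter only through Tor: their shifts are read off   *)
(* the Koszul homology of the ideal, for which the inequalities above are       *)
(* elementary diagram chases.                                                   *)

(* The argument is carried by [mreg]: the bound reg J <= s, stated as vanishing of the Koszul
   homology H_p(J) = Tor_p(J, K) in internal degrees above s + p. Two properties suffice:
   [mreg_colon], the exact sequence for the colon by a variable, and [mreg_restrict], by which
   setting a variable to zero keeps the bound.

   Let I be the edge ideal on a vertex set A and g(A) its regularity. [mreg_colon_edges] bounds reg
   (I^(|M|+d) : M) by 2d + g(A) - 2 for every product M of edges; M = 1 gives the theorem. Each
   power of I allows two units. One is spent on the colon by a special vertex x, the other on a
   further colon by a variable z for which z x M is again a product of edges, which lowers d. By
   [emul_exchange] these z are the only obstruction: for a monomial u free of them, u x M in I^q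
   forces u M in I^q. Then either an edge of M meeting N(x) can be cancelled, or only edges of A \
   N[x] matter, and the drop of g pays for the colon by x.

   The link with [reg] is dimension shifting. The shifts of any resolution bound the homology
   ([system_vanish]); for a minimal one, Nakayama's lemma gives the converse ([system_degrees]).
   Minimal resolutions exist because vanishing of H_0 in large degrees makes each syzygy module
   finitely generated; the finite bound to start from comes from [mreg_colon_edges] itself, for edge
   ideals with the crude g(A) = |A| + 1. Finally [reg_embed] makes g monotone under induced
   subgraphs. *)
From HB Require Import structures.
From mathcomp Require Import all_boot all_order all_algebra.
From mathcomp Require Import mpoly zify.
From Stdlib Require Import ClassicalEpsilon.
Require Import Defs.

Set Implicit Arguments.
Unset Strict Implicit.
Unset Printing Implicit Defensive.
Import GRing.Theory.
Local Open Scope ring_scope.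

(** * Koszul complexes *)

Section Chains.
Variable T : eqType.

(* Chains of the Koszul complex K(l; M) as binary trees, from the cone          *)
(* construction K(z :: l; M) = cone(z : K(l; M) -> K(l; M)): in (a, b), the     *)
(* component b carries the basis vector e_z.  For a graded module given by its  *)
(* homogeneous parts D, [kin D p j] selects the chains of homological degree p  *)
(* and internal degree j, and [vanish D l p j] says that the corresponding      *)
(* homology group is zero.                                                      *)

Fixpoint kos (M : zmodType) (l : seq T) : zmodType :=
  if l is _ :: l' then ((kos M l' * kos M l')%type : zmodType) else M.

Fixpoint kmap (M N : zmodType) (f : M -> N) (l : seq T) : kos M l -> kos N l :=
  if l is _ :: l' then fun c => (kmap f c.1, kmap f c.2) else f.

Fixpoint kbot (M : zmodType) (l : seq T) : kos M l -> M :=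
  if l is _ :: l' then fun c => kbot c.1 else id.

Fixpoint kin (M : zmodType) (D : nat -> M -> Prop) (l : seq T) (p j : nat) :
    kos M l -> Prop :=
  match l with
  | [::] => fun c => if p is 0 then D j c else c = 0
  | _ :: l' => fun c => kin D p j c.1 /\
      match p, j with
      | p'.+1, j'.+1 => kin D p' j' c.2
      | _, _ => c.2 = 0
      end
  end.

Lemma kmapB (M N : zmodType) (f : M -> N) l :
  {morph f : x y / x - y} -> {morph @kmap M N f l : x y / x - y}.
Proof.
move=> fB; elim: l => [|z l IH] //= [a b] [a' b'] /=.
by rewrite !IH.
Qed.

HB.instance Definition _ (M N : zmodType) (f : {additive M -> N}) l :=
  GRing.isZmodMorphism.Build _ _ (@kmap M N f l) (kmapB (raddfB f)).

Lemma kmap_comp (M N P : zmodType) (f : M -> N) (g : N -> P) l c :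
  kmap g (@kmap M N f l c) = kmap (g \o f) c.
Proof. by elim: l c => [|z l IH] //= [a b]; rewrite /= !IH. Qed.

Lemma eq_kmap (M N : zmodType) (f g : M -> N) l : f =1 g -> @kmap M N f l =1 @kmap M N g l.
Proof. by move=> fg; elim: l => [|z l IH] //= [a b] /=; rewrite !IH. Qed.

Lemma kmap_id (M : zmodType) l (c : kos M l) : kmap id c = c.
Proof. by elim: l c => [|z l IH] //= [a b]; rewrite /= !IH. Qed.

Lemma kmap_zero (M N : zmodType) l (c : kos M l) : kmap (fun=> 0 : N) c = 0.
Proof. by elim: l c => [|z l IH] //= [a b]; rewrite /= !IH. Qed.

Lemma kbot_kmap (M N : zmodType) (f : M -> N) l c :
  kbot (@kmap M N f l c) = f (kbot c).
Proof. by elim: l c => [|z l IH] //= [a b]. Qed.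

Lemma kmap_cancel (M N : zmodType) (f : M -> N) (g : N -> M) l :
  cancel f g -> cancel (@kmap M N f l) (@kmap N M g l).
Proof.
by move=> fK c; rewrite kmap_comp -[RHS]kmap_id; apply: eq_kmap => m /=.
Qed.

Section Graded.
Variables (M : zmodType) (D : nat -> M -> Prop).
Hypothesis D0 : forall j, D j 0.
Hypothesis DB : forall j x y, D j x -> D j y -> D j (x - y).

Lemma kin0 l p j : @kin M D l p j 0.
Proof.
elim: l p j => [|z l IH] [|p] [|j] //=; split=> //; exact: IH.
Qed.

Lemma kinB l p j x y : @kin M D l p j x -> kin D p j y -> kin D p j (x - y).
Proof.
elim: l p j x y => [|z l IH] p j /=.
  by case: p => [|p] x y; [exact: DB | move=> -> ->; rewrite subr0].
move=> [a b] [a' b'] /= [Ha Hb] [Ha' Hb']; split; first exact: IH.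
move: Hb Hb'; case: p j {Ha Ha'} => [|p] [|j]; try by move=> -> ->; rewrite subr0.
exact: IH.
Qed.

Lemma kinN l p j x : @kin M D l p j x -> kin D p j (- x).
Proof. by move=> H; rewrite -sub0r; apply: kinB => //; apply: kin0. Qed.

Lemma kinD l p j x y : @kin M D l p j x -> kin D p j y -> kin D p j (x + y).
Proof. by move=> Hx Hy; rewrite -[y]opprK; apply: kinB => //; apply: kinN. Qed.
End Graded.


(* A chain in [kin D p j] only has coefficients of degree [j - p]. *)
Lemma kin_map (M N : zmodType) (D : nat -> M -> Prop) (E : nat -> N -> Prop)
    (f : M -> N) (e : nat) (l : seq T) (p j : nat) (c : kos M l) :
  f 0 = 0 -> (forall i, E i 0) ->
  (forall i m, (i + p = j)%N -> D i m -> E (i + e)%N (f m)) ->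
  kin D p j c -> kin E p (j + e) (kmap f c).
Proof.
move=> f0 E0; have f0l l' : @kmap M N f l' 0 = 0 by elim: l' => //= z l' ->.
elim: l p j c => [|z l IH] p j /=.
  case: p => [|p] c H; last by move=> ->.
  by apply: H; rewrite addn0.
move=> [a b] H /= [Ha Hb]; split; first exact: IH.
case: p j H Ha Hb => [|p] [|j] H Ha /= Hb; try by rewrite Hb f0l //; case: (e).
  by rewrite Hb f0l add0n; case: (e) => // e'; apply: kin0 => i.
apply: IH Hb => i m Hi; apply: H; by rewrite addnS Hi.
Qed.

(** Counterpart of [kin_map] for maps of degree -1, such as division by a variable, which must kill
    coefficients of degree 0. *)
Lemma kin_low (M N : zmodType) (D : nat -> M -> Prop) (E : nat -> N -> Prop)
    (f : M -> N) (l : seq T) (p j : nat) (c : kos M l) :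
  f 0 = 0 -> (forall m, D 0%N m -> f m = 0) ->
  (forall i m, D i.+1 m -> E i (f m)) ->
  kin D p j.+1 c -> kin E p j (kmap f c).
Proof.
move=> f0 D0 H; have f0l l' : @kmap M N f l' 0 = 0 by elim: l' => //= z l' ->.
have Z : forall l' p' (c' : kos M l'), kin D p' 0 c' -> kmap f c' = 0.
  elim=> [|z l' IH] p' /=; first by case: p' => [|p'] c'; [exact: D0 | move=> ->].
  by move=> [a b] /= [/IH -> Hb]; case: p' Hb => [|p'] ->; rewrite f0l.
elim: l p j c => [|z l IH] p j /=; first by case: p => [|p] c; [exact: H | move=> ->].
move=> [a b] /= [Ha Hb]; split; first exact: IH.
case: p Ha Hb => [|p] Ha Hb; first by rewrite Hb f0l.
by case: j Ha Hb => [|j] Ha Hb; [apply: Z Hb | apply: IH].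
Qed.

Lemma kin_low0 (M N : zmodType) (D : nat -> M -> Prop)
    (f : M -> N) (l : seq T) (p : nat) (c : kos M l) :
  f 0 = 0 -> (forall m, D 0%N m -> f m = 0) -> kin D p 0 c -> kmap f c = 0.
Proof.
move=> f0 D0; have f0l l' : @kmap M N f l' 0 = 0 by elim: l' => //= z l' ->.
elim: l p c => [|z l' IH] p /=; first by case: p => [|p] c; [exact: D0 | move=> ->].
by move=> [a b] /= [/IH -> Hb]; case: p Hb => [|p] ->; rewrite f0l.
Qed.

Lemma kin_lift (M N : zmodType) (D : nat -> M -> Prop) (E : nat -> N -> Prop)
    (f : M -> N) (l : seq T) (p j : nat) (c : kos N l) :
  f 0 = 0 -> (forall i m, E i m -> exists2 m', D i m' & f m' = m) ->
  kin E p j c -> exists2 c', kin D p j c' & kmap f c' = c.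
Proof.
move=> f0 H; have f0l l' : @kmap M N f l' 0 = 0 by elim: l' => //= z l' ->.
elim: l p j c => [|z l IH] p j /=.
  by case: p => [|p] c; [exact: H | move=> ->; exists 0].
move=> [a b] /= [/IH [a' Ha' <-] Hb].
case: p j Ha' Hb => [|p] [|j] Ha' Hb; try by exists (a', 0); rewrite //= Hb f0l.
by have [b' Hb' <-] := IH _ _ _ Hb; exists (a', b').
Qed.

Lemma kin_ker (M N : zmodType) (D : nat -> M -> Prop) (f : M -> N)
    (l : seq T) (p j : nat) (c : kos M l) :
  kin D p j c -> kmap f c = 0 -> kin (fun j m => D j m /\ f m = 0) p j c.
Proof.
elim: l p j c => [|z l IH] p j; first by case: p => [|p] c /=.
move=> [a b] /= [Ha Hb] [Ea Eb]; split; first exact: IH.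
by case: p j Ha Hb => [|p] [|j] Ha Hb //; apply: IH.
Qed.

Section Differential.
Variables (M : zmodType) (act : T -> {additive M -> M}).
Hypothesis actC : forall y z m, act y (act z m) = act z (act y m).

Fixpoint kd (l : seq T) : kos M l -> kos M l :=
  if l is z :: l' then fun c => (kd c.1 + kmap (act z) c.2, - kd c.2)
  else fun=> 0.

Lemma kdB l : {morph @kd l : x y / x - y}.
Proof.
elim: l => [|z l IH]; first by move=> x y; rewrite /= subr0.
move=> [a b] [a' b'] /=; apply: (f_equal2 pair) => /=.
  by rewrite IH (kmapB (raddfB (act z))) opprD addrACA.
by rewrite IH opprD.
Qed.

HB.instance Definition _ l := GRing.isZmodMorphism.Build _ _ (@kd l) (@kdB l).

Lemma kd_kmap (f : {additive M -> M}) l c :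
  (forall z m, z \in l -> f (act z m) = act z (f m)) ->
  kd (@kmap M M f l c) = kmap f (kd c).
Proof.
elim: l c => [|z l IH] /=; first by move=> c; rewrite raddf0.
move=> [a b] H /=; have H' y m : y \in l -> f (act y m) = act y (f m).
  by move=> yl; apply: H; rewrite inE yl orbT.
rewrite !IH // raddfD raddfN; congr (_ + _, _).
rewrite /= !kmap_comp; apply: eq_kmap => m /=.
by rewrite H // mem_head.
Qed.

Lemma kd_act z l c : kd (kmap (act z) c) = kmap (act z) (@kd l c).
Proof. by apply: kd_kmap => y m _; rewrite actC. Qed.

Lemma kd_kd l c : @kd l (kd c) = 0.
Proof.
elim: l c => [|z l IH] //= [a b] /=.
apply: (f_equal2 pair) => /=; last by rewrite raddfN /= IH oppr0 oppr0.
by rewrite raddfD /= IH add0r kd_act raddfN /= subrr.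
Qed.

Section Graded.
Variable D : nat -> M -> Prop.
Hypothesis D0 : forall j, D j 0.
Hypothesis DB : forall j x y, D j x -> D j y -> D j (x - y).
Hypothesis Dact : forall z j x, D j x -> D j.+1 (act z x).

Lemma kin_act z l p j c : kin D p j c -> kin D p j.+1 (@kmap M M (act z) l c).
Proof.
by rewrite -addn1; apply: kin_map; rewrite ?raddf0 // => i m _; rewrite addn1; apply: Dact.
Qed.

Lemma kd_kin0 l j (c : kos M l) : kin D 0 j c -> kd c = 0.
Proof.
elim: l j c => [|z l IH] j //= [a b] /= [/IH -> ->].
by rewrite !raddf0 ?oppr0 addr0.
Qed.

Lemma kd_kin l p j (c : kos M l) : kin D p.+1 j c -> kin D p j (kd c).
Proof.
elim: l p j c => [|z l IH] p j; first by case: p => [|p] /= c _.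
move=> [a b] /= [Ha Hb]; case: j Ha Hb => [|j] Ha Hb.
  rewrite Hb !raddf0 addr0; split; first exact: IH.
  by rewrite ?oppr0; case: p {Ha Hb}.
split; first by apply: kinD => //; [apply: IH | apply: kin_act].
case: p Ha Hb => [|p] Ha Hb; first by rewrite (kd_kin0 Hb) oppr0.
by apply: kinN => //; apply: IH.
Qed.
End Graded.

Definition vanish (D : nat -> M -> Prop) (l : seq T) (p j : nat) : Prop :=
  forall c : kos M l, kin D p j c -> kd c = 0 ->
  exists2 b : kos M l, kin D p.+1 j b & kd b = c.

Lemma vanish_eq (D E : nat -> M -> Prop) l p j :
  (forall i m, D i m <-> E i m) -> vanish D l p j -> vanish E l p j.
Proof.
move=> DE H c Hc dc.
have mono (D1 D2 : nat -> M -> Prop) : (forall i m, D1 i m <-> D2 i m) ->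
    forall q i (x : kos M l), kin D1 q i x -> kin D2 q i x.
  move=> H12; elim: l {H c Hc dc} => [|z l IH] q i; first by case: q => [|q] x //= /H12.
  move=> [a b] /= [Ha Hb]; split; first exact: IH.
  by case: q i Ha Hb => [|q] [|i] Ha Hb //; apply: IH.
have [b Hb db] := H c (mono _ _ (fun i m => iff_sym (DE i m)) _ _ _ Hc) dc.
by exists b => //; apply: mono Hb.
Qed.

End Differential.

Section Shift.
Variables (M N : zmodType).
Variables (actM : T -> {additive M -> M}) (actN : T -> {additive N -> N}).
Hypothesis actMC : forall y z m, actM y (actM z m) = actM z (actM y m).
Variables (f : {additive M -> N}).
Hypothesis f_act : forall z m, f (actM z m) = actN z (f m).
Variables (D : nat -> M -> Prop) (E : nat -> N -> Prop).
Hypothesis D0 : forall j, D j 0.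
Hypothesis DB : forall j x y, D j x -> D j y -> D j (x - y).
Hypothesis Dact : forall z j x, D j x -> D j.+1 (actM z x).
Hypothesis E0 : forall j, E j 0.
Hypothesis DE : forall j m, D j m -> E j (f m).
Hypothesis ED : forall j m, E j m -> exists2 m', D j m' & f m' = m.

Let K j m := D j m /\ f m = 0.

Lemma kd_map l (c : kos M l) : kd actN (kmap f c) = kmap f (kd actM c).
Proof.
elim: l c => [|z l IH] /=; first by move=> c; rewrite raddf0.
move=> [a b] /=; rewrite !IH // raddfD raddfN; congr (_ + _, _).
by rewrite /= !kmap_comp; apply: eq_kmap => m /=; rewrite f_act.
Qed.

Lemma kin_im l p j (c : kos M l) : kin D p j c -> kin E p j (kmap f c).
Proof.
by rewrite -{2}[j]addn0; apply: kin_map; rewrite ?raddf0 // => i m _; rewrite addn0; apply: DE.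
Qed.

Lemma kinK l p j (c : kos M l) : kin K p j c -> kin D p j c.
Proof.
rewrite -{2}[j]addn0 -{2}[c]kmap_id; apply: kin_map => // i m _ [].
by rewrite addn0.
Qed.

Lemma kinK_eq0 l p j (c : kos M l) : kin K p j c -> kmap f c = 0.
Proof.
elim: l p j c => [|z l IH] p j /=; first by case: p => [|p] c; [case | move=> ->; rewrite raddf0].
have f0l l' : @kmap M N f l' 0 = 0 by elim: l' => [|z' l' IHl] /=; rewrite ?IHl ?raddf0.
move=> [a b] /= [/IH -> Hb]; case: p j Hb => [|p] [|j]; try by move=> ->; rewrite f0l.
by move=> /IH ->.
Qed.

(** In the long exact sequence of 0 -> K -> D -> E -> 0, H_(p+1)(E) sits between H_(p+1)(D) and
    H_p(K). *)
Lemma vanish_image l p j :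
  vanish actM D l p.+1 j -> vanish actM K l p j -> vanish actN E l p.+1 j.
Proof.
move=> VD VK c Hc dc; have [c1 Hc1 fc1] := kin_lift (raddf0 f) ED Hc.
have fd : kmap f (kd actM c1) = 0 by rewrite -kd_map fc1.
have [w Hw dw] : exists2 w : kos M l, kin K p.+1 j w & kd actM w = kd actM c1.
  by apply: VK; [apply: kin_ker => //; apply: kd_kin | apply: kd_kd].
have [b Hb db] : exists2 b : kos M l, kin D p.+2 j b & kd actM b = c1 - w.
  by apply: VD; [apply: kinB => //; apply: kinK | rewrite raddfB /= dw subrr].
exists (kmap f b); first exact: kin_im.
by rewrite kd_map db (kmapB (raddfB f)) fc1 (kinK_eq0 Hw) subr0.
Qed.

(** H_(p+1)(E) maps onto H_p(K) as soon as H_p(K) -> H_p(D) is zero. This is weaker than H_p(D) = 0,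
    which fails for free D and p = 0; there minimality will make the map zero. *)
Lemma vanish_kernel l p j :
  (forall c : kos M l, kin K p j c -> kd actM c = 0 ->
     exists2 b : kos M l, kin D p.+1 j b & kd actM b = c) ->
  vanish actN E l p.+1 j -> vanish actM K l p j.
Proof.
move=> VD VE c Hc dc; have [b Hb db] := VD c Hc dc.
have [e He de] : exists2 e : kos N l, kin E p.+2 j e & kd actN e = kmap f b.
  by apply: VE; [apply: kin_im | rewrite kd_map db (kinK_eq0 Hc)].
have [e1 He1 fe1] := kin_lift (raddf0 f) ED He.
exists (b - kd actM e1); last by rewrite raddfB /= db kd_kd ?subr0.
apply: kin_ker; first by apply: kinB => //; apply: kd_kin.
by rewrite (kmapB (raddfB f)) -kd_map fe1 de subrr.
Qed.

End Shift.

Lemma kin_sub (M : zmodType) (D E : nat -> M -> Prop) l p j (c : kos M l) :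
  (forall i, E i 0) -> (forall i m, (i + p = j)%N -> D i m -> E i m) ->
  kin D p j c -> kin E p j c.
Proof.
move=> E0 DE; rewrite -{2}[j]addn0 -{2}[c]kmap_id; apply: kin_map => // i m.
by rewrite addn0; apply: DE.
Qed.

(** * Setting a variable to zero: retraction, homotopy and colon sequence *)

Section Homotopy.
Variables (M : zmodType) (act : T -> {additive M -> M}).
Hypothesis actC : forall y z m, act y (act z m) = act z (act y m).
Variables (y : T) (rho delta : {additive M -> M}).
Hypothesis rho_act : forall z m, rho (act z m) = if z == y then 0 else act z (rho m).
Hypothesis delta_act : forall z m, delta (act z m) = if z == y then m else act z (delta m).
Hypothesis rho_delta : forall m, rho m + act y (delta m) = m.

Fixpoint kpi (l : seq T) : kos M l -> kos M l :=
  if l is z :: l' then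
    fun c => if z == y then (kmap rho c.1, 0) else (kpi c.1, kpi c.2)
  else id.

(** Division by y followed by multiplication by e_y; the sign comes from moving e_y past the other
    basis vectors. *)
Fixpoint kh (l : seq T) : kos M l -> kos M l :=
  if l is z :: l' then
    fun c => if z == y then (0, kmap delta c.1) else (kh c.1, - kh c.2)
  else fun=> 0.

Lemma kpiB l : {morph @kpi l : a b / a - b}.
Proof.
elim: l => //= z l IH [a b] [a' b'] /=; case: eqP => _.
  by rewrite (kmapB (raddfB rho)); congr (_, _); rewrite subrr.
by rewrite !IH.
Qed.

Lemma khB l : {morph @kh l : a b / a - b}.
Proof.
elim: l => [a b|z l IH [a b] [a' b']] /=; first by rewrite subrr.
case: eqP => _.
  by rewrite (kmapB (raddfB delta)); congr (_, _); rewrite subrr.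
by rewrite !IH; congr (_, _); rewrite opprD.
Qed.

HB.instance Definition _ l := GRing.isZmodMorphism.Build _ _ (@kpi l) (@kpiB l).
HB.instance Definition _ l := GRing.isZmodMorphism.Build _ _ (@kh l) (@khB l).

Lemma kmap_rho_delta l (c : kos M l) : kmap rho c + kmap (act y) (kmap delta c) = c.
Proof.
elim: l c => [|z l IH] c /=; first exact: rho_delta.
by case: c => a b; apply: (f_equal2 pair) => /=; apply: IH.
Qed.

Lemma kpi_act z l (c : kos M l) : z != y ->
  kpi (kmap (act z) c) = kmap (act z) (kpi c).
Proof.
move=> zy; elim: l c => [|x l IH] //= [a b] /=; case: eqP => _ /=; last by rewrite !IH.
congr (_, _); last by rewrite raddf0.
by rewrite /= !kmap_comp; apply: eq_kmap => m /=; rewrite rho_act (negPf zy).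
Qed.

Lemma kh_act z l (c : kos M l) : z != y ->
  kh (kmap (act z) c) = kmap (act z) (kh c).
Proof.
move=> zy; elim: l c => [|x l IH] /=; first by move=> c; rewrite raddf0.
move=> [a b] /=; case: eqP => _ /=; last by rewrite !IH raddfN.
congr (_, _); first by rewrite raddf0.
by rewrite /= !kmap_comp; apply: eq_kmap => m /=; rewrite delta_act (negPf zy).
Qed.

Lemma kd_rho l c : y \notin l -> kd act (@kmap M M rho l c) = kmap rho (kd act c).
Proof.
by move=> yl; apply: kd_kmap => z m zl; rewrite rho_act; case: eqP yl => // <-; rewrite zl.
Qed.

Lemma kd_delta l c : y \notin l -> kd act (@kmap M M delta l c) = kmap delta (kd act c).
Proof.
by move=> yl; apply: kd_kmap => z m zl; rewrite delta_act; case: eqP yl => // <-; rewrite zl.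
Qed.

Lemma kd_kpi l c : uniq l -> y \in l -> kd act (@kpi l c) = kpi (kd act c).
Proof.
elim: l c => [|z l IH] //= [a b] /andP[zl ul]; rewrite inE eq_sym.
case: eqVneq => /= [zy _|zy yl].
  apply: (f_equal2 pair) => /=; last by rewrite raddf0 oppr0.
  rewrite raddf0 addr0 kd_rho -?zy // raddfD /= [X in _ = _ + X]kmap_comp.
  rewrite [X in _ = _ + X](_ : _ = 0) ?addr0 //.
  rewrite -[RHS](kmap_zero _ b); apply: eq_kmap => m /=.
  by rewrite rho_act zy eqxx.
by rewrite !IH // raddfD /= kpi_act // raddfN.
Qed.

(** At the factor y this is the splitting [rho_delta] of a coefficient into its part free of y and y
    times a quotient. The other factors carry it along, the sign in [kh] cancelling the cross
    terms. *)
Lemma kh_homotopy l c : uniq l -> y \in l ->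
  kd act (@kh l c) + kh (kd act c) + kpi c = c.
Proof.
elim: l c => [|z l IH] //= [a b] /andP[zl ul]; rewrite inE eq_sym.
case: eqVneq => /= [zy _|zy yl].
  apply: (f_equal2 pair) => /=.
    by rewrite raddf0 add0r addr0 zy addrC kmap_rho_delta.
  rewrite kd_delta -?zy // raddfD /= addrA addNr add0r addr0 kmap_comp.
  rewrite -[RHS]kmap_id; apply: eq_kmap => m /=.
  by rewrite delta_act zy eqxx.
have := IH a ul yl; have := IH b ul yl; set ha := kh a; set hb := kh b => Eb Ea.
apply: (f_equal2 pair) => /=.
  rewrite -[RHS]Ea !raddfD /= !raddfN /= kh_act // -/hb.
  by rewrite addrACA addNr addr0.
by rewrite -[RHS]Eb !raddfN /= !opprK.
Qed.

Lemma kin_kpi (D E : nat -> M -> Prop) l p j c :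
  (forall i, E i 0) -> (forall i m, D i m -> E i (rho m)) -> y \in l ->
  @kin M D l p j c -> kin E p j (kpi c).
Proof.
move=> E0 Hr; elim: l p j c => //= z l IH p j [a b]; rewrite inE eq_sym.
case: eqVneq => /= [zy _|zy yl] [Ha Hb].
  split; last by case: p j {Ha Hb} => [|p] [|j] //; apply: kin0.
  by rewrite -[j]addn0; apply: kin_map Ha; rewrite ?raddf0 // => i m _; rewrite addn0; apply: Hr.
split; first exact: IH.
case: p j Ha Hb => [|p] [|j] Ha Hb; try by rewrite Hb raddf0.
exact: IH.
Qed.

Lemma kin_kh (D : nat -> M -> Prop) l p j c :
  (forall i, D i 0) -> (forall i a b, D i a -> D i b -> D i (a - b)) ->
  (forall i m, D i.+1 m -> D i (delta m)) -> (forall m, D 0%N m -> delta m = 0) ->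
  @kin M D l p j c -> kin D p.+1 j (kh c).
Proof.
move=> D0 DB Hd Hd0; elim: l p j c => //= z l IH p j [a b].
case: eqVneq => /= [zy|zy] [Ha Hb].
  split; first exact: kin0.
  case: j Ha Hb => [|j] Ha Hb; first by apply: kin_low0 Ha; rewrite ?raddf0.
  by apply: kin_low Ha; rewrite ?raddf0.
split; first exact: IH.
case: p j Ha Hb => [|p] [|j] Ha Hb; try by rewrite Hb raddf0 ?oppr0 //; apply: kin0.
by apply: kinN => //; apply: IH.
Qed.

(* Setting [y] to zero in the coefficients is a retraction up to homotopy. *)
Lemma vanish_retract (D E : nat -> M -> Prop) l p j :
  uniq l -> y \in l -> (forall i, E i 0) ->
  (forall i a b, E i a -> E i b -> E i (a - b)) ->
  (forall i m, E i.+1 m -> E i (delta m)) -> (forall m, E 0%N m -> delta m = 0) ->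
  (forall i m, E i m -> D i m) -> (forall i m, D i m -> E i (rho m)) ->
  (forall i, D i 0) ->
  vanish act D l p j -> vanish act E l p j.
Proof.
move=> ul yl E0 EB Ed Ed0 ED DE D0 VD c Hc dc.
have [b Hb db] := VD c (kin_sub D0 (fun i m _ => @ED i m) Hc) dc.
(* From c = d b in D and d c = 0 follows c = d (h c) + pi c = d (h c + pi b), where pi b has
   coefficients in E. *)
exists (kpi b + kh c).
  by apply: kinD => //; [apply: kin_kpi Hb | apply: kin_kh].
by rewrite raddfD /= kd_kpi // db -[RHS](kh_homotopy c ul yl) dc raddf0 addr0 addrC.
Qed.

(* The long exact sequence of J : y -> J -> J / y (J : y), at chain level: D is *)
(* J, C is J : y and E is generated by the elements of J not involving y.       *)
Lemma vanish_colon (D E C : nat -> M -> Prop) l p j :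
  (forall i, D i 0) -> (forall i a b, D i a -> D i b -> D i (a - b)) ->
  (forall i, E i 0) -> (forall i a b, E i a -> E i b -> E i (a - b)) ->
  (forall i, C i 0) -> (forall i a b, C i a -> C i b -> C i (a - b)) ->
  (forall z i m, E i m -> E i.+1 (act z m)) ->
  (forall i m, E i.+1 m -> E i (delta m)) -> (forall m, E 0%N m -> delta m = 0) ->
  (forall i m, D i m -> E i (rho m)) ->
  (forall i m, D i.+1 m -> C i (delta m)) -> (forall m, D 0%N m -> delta m = 0) ->
  (forall i m, C i m -> D i.+1 (act y m)) ->
  (forall i m, E i m -> D i m) -> (forall i m, E i m -> C i m) ->
  vanish act C l p j -> vanish act E l p j.+1 ->
  (if p is p'.+1 then vanish act E l p' j else True) ->
  vanish act D l p j.+1.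
Proof.
move=> D0 DB E0 EB C0 CB Eact Ed Ed0 Dr Dd Dd0 CD ED EC VC VE VE' c Hc dc.
set c0 := kmap rho c; set c1 := kmap delta c.
have cE : c0 + kmap (act y) c1 = c by apply: kmap_rho_delta.
have Hc0 : kin E p j.+1 c0.
  rewrite -[j.+1]addn0; apply: kin_map Hc; rewrite ?raddf0 // => i m _.
  by rewrite addn0; apply: Dr.
have Hc1 : kin C p j c1 by apply: kin_low Hc; rewrite ?raddf0.
have actK l' : cancel (@kmap M M (act y) l') (@kmap M M delta l').
  by apply: kmap_cancel => m; rewrite delta_act eqxx.
have dc0 : kd act c0 = - kmap (act y) (kd act c1).
  by apply/eqP; rewrite -subr_eq0 opprK -kd_act // -raddfD /= cE dc.
(* Dividing d c0 = - y d c1 by y shows that - d c1 is a cycle of E, so it bounds some w. Then c =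
   (c0 - y w) + y (c1 + w) splits c into a cycle of E and y times a cycle of C. *)
have [w Hw dw] : exists2 w, kin E p j w & kd act w = - kd act c1.
  case: p VE' Hc Hc0 Hc1 {VC VE} => [|p] VE' Hc Hc0 Hc1.
    exists 0; first exact: kin0.
    by rewrite raddf0 (kd_kin0 act Hc1) oppr0.
  have wE : kmap delta (kd act c0) = - kd act c1 by rewrite dc0 raddfN /= actK.
  apply: VE'; last by rewrite raddfN /= kd_kd ?oppr0.
  rewrite -wE; apply: (@kin_low _ _ E E) => //; first exact: raddf0.
  exact: kd_kin.
have [b Hb db] : exists2 b, kin E p.+1 j.+1 b & kd act b = c0 - kmap (act y) w.
  apply: VE; first by apply: kinB => //; apply: kin_act.
  by rewrite raddfB /= dc0 kd_act // dw raddfN /= subrr.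
have [e He de] : exists2 e, kin C p.+1 j e & kd act e = c1 + w.
  apply: VC; last by rewrite raddfD /= dw subrr.
  by apply: kinD => //; apply: kin_sub Hw => // i m _; apply: EC.
exists (b + kmap (act y) e).
  apply: kinD => //; first by apply: kin_sub Hb => // i m _; apply: ED.
  rewrite -[j.+1]addn1; apply: kin_map He; rewrite ?raddf0 // => i m _.
  by rewrite addn1; apply: CD.
by rewrite raddfD /= db kd_act // de raddfD /= addrACA addNr addr0.
Qed.

End Homotopy.

Section Acyclic.
Variables (M : zmodType) (act : T -> {additive M -> M}).
Variables (rho delta : T -> {additive M -> M}).
Hypothesis rho_act : forall y z m,
  rho y (act z m) = if z == y then 0 else act z (rho y m).
Hypothesis rho_delta : forall y m, rho y m + act y (delta y m) = m.
Variable D : nat -> M -> Prop.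
Hypothesis D0 : forall j, D j 0.
Hypothesis Drho : forall y j m, D j m -> D j (rho y m).
Hypothesis Ddelta : forall y j m, D j.+1 m -> D j (delta y m).
Hypothesis Ddelta0 : forall y m, D 0%N m -> delta y m = 0.
Hypothesis delta_act : forall y z m,
  delta y (act z m) = if z == y then m else act z (delta y m).

(** Induction on the variables: in a cycle (a, b) the part of a free of z is again a cycle and
    bounds over the remaining variables, while the quotient of a by z supplies the e_z component.
    Only in homological degree 0 can something survive, namely the coefficient with all variables
    set to zero. *)
Lemma koszul_acyclic l p j (c : kos M l) : uniq l -> kin D p j c -> kd act c = 0 ->
  (p = 0%N -> foldl (fun m y => rho y m) (kbot c) l = 0) ->
  exists2 b : kos M l, kin D p.+1 j b & kd act b = c.
Proof.
elim: l p j c => [|z l IH] p j.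
  by case: p => [|p] c _ Hc _ Hz; exists 0; rewrite //= ?Hc // -(Hz erefl).
move=> [a b] /= /andP[zl ul] [Ha Hb] [da db] Hz.
have Hra : kin D p j (kmap (rho z) a).
  by rewrite -[j]addn0; apply: kin_map Ha; rewrite ?raddf0 // => i m _; rewrite addn0; apply: Drho.
have dra : kd act (kmap (rho z) a) = 0.
  have := f_equal (@kmap M M (rho z) l) da; rewrite raddf0 raddfD /= kd_kmap; last first.
    by move=> y m yl; rewrite rho_act; case: eqP zl => // <-; rewrite yl.
  rewrite [X in _ + X](_ : _ = 0) ?addr0 //.
  rewrite -[RHS](kmap_zero _ b) kmap_comp; apply: eq_kmap => m /=.
  by rewrite rho_act eqxx.
have Hra0 : p = 0%N -> foldl (fun m y => rho y m) (kbot (kmap (rho z) a)) l = 0.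
  by move=> /Hz <-; rewrite kbot_kmap.
have [b' Hb' db'] := IH p j _ ul Hra dra Hra0.
exists (b', kmap (delta z) a).
  split=> //=; case: j Ha {Hb Hra Hb'} => [|j] Ha.
    by apply: kin_low0 Ha; rewrite ?raddf0 // => m; apply: Ddelta0.
  by apply: kin_low Ha; rewrite ?raddf0 //; [move=> m; apply: Ddelta0 | move=> i m; apply: Ddelta].
have E1 : kd act b' + kmap (act z) (kmap (delta z) a) = a.
  by rewrite db' (kmap_rho_delta (rho_delta z)).
apply: (f_equal2 pair) => /=; first exact: E1.
rewrite kd_kmap; last first.
  by move=> y m yl; rewrite delta_act; case: eqP zl => // <-; rewrite yl.
have -> : kd act a = - kmap (act z) b by apply/eqP; rewrite -addr_eq0 da.
rewrite raddfN /= opprK kmap_comp -[RHS]kmap_id; apply: eq_kmap => m /=.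
by rewrite delta_act eqxx.
Qed.

End Acyclic.

End Chains.

(** * Koszul homology of monomial ideals *)

Section Rows.
Variables (K : fieldType) (n : nat).
Local Notation S := {mpoly K[n]}.
Local Notation mon := 'X_{1..n}.
Implicit Types (p q : S) (u w : mon) (y z : 'I_n).

Definition prho y p : S := \sum_(u <- msupp p | u y == 0%N) p@_u *: 'X_[u].
Definition pdelta y p : S :=
  \sum_(u <- msupp p | u y != 0%N) p@_u *: 'X_[(u - U_(y))%MM].

Lemma sum_coeff (P : pred mon) p w :
  \sum_(u <- msupp p | P u) p@_u * (u == w)%:R = if P w then p@_w else 0.
Proof.
case: (boolP (w \in msupp p)) => [wp|wp].
  rewrite (bigID (pred1 w)) /= [X in _ + X]big1 ?addr0; last first.
    by move=> u /andP[_ /negPf ->]; rewrite mulr0.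
  rewrite -big_filter (_ : filter _ _ = if P w then [:: w] else [::]).
    by case: ifP => _; rewrite ?big_seq1 ?big_nil ?eqxx ?mulr1.
  have -> : [seq i <- msupp p | P i & i == w] = [seq i <- [seq j <- msupp p | j == w] | P i].
    by rewrite -filter_predI; apply: eq_filter => i /=.
  by rewrite filter_pred1_uniq //= msupp_uniq.
rewrite big_seq_cond big1; first by rewrite memN_msupp_eq0 // if_same.
by move=> u /andP[up _]; case: eqP up wp => [-> ->|_ _ _] //; rewrite mulr0.
Qed.

Lemma mcoeff_prho y p w : (prho y p)@_w = if w y == 0%N then p@_w else 0.
Proof.
rewrite /prho raddf_sum /= -(sum_coeff (fun u : mon => u y == 0%N)).
by apply: eq_bigr => u _; rewrite mcoeffZ mcoeffX.
Qed.

Lemma mcoeff_pdelta y p w : (pdelta y p)@_w = p@_(w + U_(y)).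
Proof.
rewrite /pdelta raddf_sum /=.
have := sum_coeff (fun u : mon => u y != 0%N) p (w + U_(y))%MM.
rewrite mnmDE mnm1E eqxx addn1 /= => <-; apply: eq_bigr => u uy.
rewrite mcoeffZ mcoeffX; congr (_ * _%:R); congr (nat_of_bool _).
apply/eqP/eqP => [<-|->]; last by rewrite addmK.
by rewrite submK // lep1mP.
Qed.

Lemma mcoeff_XM y p w : ('X_y * p)@_w = if w y == 0%N then 0 else p@_(w - U_(y)).
Proof.
rewrite mulrC; case: ifPn => wy; last first.
  by rewrite -[in LHS](submK (m := U_(y)) (m' := w)) ?lep1mP // addmC mcoeffMX.
apply: memN_msupp_eq0; rewrite (perm_mem (msuppMX p U_(y))); apply/mapP => -[u _ E].
by move: wy; rewrite E mnmDE mnm1E eqxx; lia.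
Qed.

Lemma prhoB y : {morph prho y : p q / p - q}.
Proof.
move=> p q; apply/mpolyP => w; rewrite mcoeffB !mcoeff_prho mcoeffB.
by case: ifP; rewrite ?subrr.
Qed.
HB.instance Definition _ y := GRing.isZmodMorphism.Build S S (prho y) (prhoB y).

Lemma pdeltaB y : {morph pdelta y : p q / p - q}.
Proof. by move=> p q; apply/mpolyP => w; rewrite mcoeffB !mcoeff_pdelta mcoeffB. Qed.
HB.instance Definition _ y := GRing.isZmodMorphism.Build S S (pdelta y) (pdeltaB y).

Lemma prho_X y z p : prho y ('X_z * p) = if z == y then 0 else 'X_z * prho y p.
Proof.
apply/mpolyP => w; rewrite mcoeff_prho mcoeff_XM; case: (eqVneq z y) => [->|zy].
  by rewrite mcoeff0; case: (w y) => [|k] ; rewrite ?eqxx.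
rewrite mcoeff_XM mcoeff_prho mnmBE mnm1E (negPf zy) subn0.
by do 2 case: ifP.
Qed.

Lemma pdelta_X y z p : pdelta y ('X_z * p) = if z == y then p else 'X_z * pdelta y p.
Proof.
apply/mpolyP => w; rewrite mcoeff_pdelta mcoeff_XM mnmDE mnm1E [y == z]eq_sym.
case: (eqVneq z y) => [->|zy]; first by rewrite addn1 /= addmK.
rewrite addn0 mcoeff_XM mcoeff_pdelta; case: ifPn => // wz; congr (_@_ _).
apply/mnmP => i; rewrite !(mnmBE, mnmDE, mnm1E);
case: (eqVneq z i) wz zy => [->|_] wi zy; last by rewrite !subn0.
by rewrite eq_sym (negPf zy) !addn0.
Qed.

Lemma prho_pdelta y p : prho y p + 'X_y * pdelta y p = p.
Proof.
apply/mpolyP => w; rewrite mcoeffD mcoeff_prho mcoeff_XM mcoeff_pdelta.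
by case: ifPn => wy; rewrite ?addr0 // add0r submK // lep1mP.
Qed.

Section Module.
Variable m : nat.
Local Notation M := 'rV[S]_m.

Definition xact z : {additive M -> M} := *:%R 'X_z.
Definition rrho y : {additive M -> M} := map_mx (prho y).
Definition rdelta y : {additive M -> M} := map_mx (pdelta y).

Lemma xactC y z (v : M) : xact y (xact z v) = xact z (xact y v).
Proof. by rewrite /xact /= !scalerA mulrC. Qed.

Lemma xactE z (v : M) k : xact z v 0 k = 'X_z * v 0 k.
Proof. by rewrite mxE. Qed.

Lemma rrhoE y (v : M) k : rrho y v 0 k = prho y (v 0 k).
Proof. by rewrite mxE. Qed.

Lemma rdeltaE y (v : M) k : rdelta y v 0 k = pdelta y (v 0 k).
Proof. by rewrite mxE. Qed.

Lemma rrho_act y z v : rrho y (xact z v) = if z == y then 0 else xact z (rrho y v).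
Proof.
by apply/rowP => k; rewrite rrhoE xactE prho_X; case: eqP => _; rewrite ?mxE.
Qed.

Lemma rdelta_act y z v : rdelta y (xact z v) = if z == y then v else xact z (rdelta y v).
Proof.
by apply/rowP => k; rewrite rdeltaE xactE pdelta_X; case: eqP => _; rewrite ?mxE.
Qed.

Lemma rrho_delta y v : rrho y v + xact y (rdelta y v) = v.
Proof. by apply/rowP => k; rewrite mxE rrhoE xactE rdeltaE prho_pdelta. Qed.

(** One notion serves two purposes: a graded free module when U is everything, a monomial ideal when
    there is one generator, in degree 0. *)
Definition homrow (sh : 'I_m -> nat) (U : mon -> Prop) (j : nat) (v : M) : Prop :=
  forall k u, (v 0 k)@_u != 0 -> (mdeg u + sh k)%N = j /\ U u.

Section Homrow.
Variables (sh : 'I_m -> nat) (U : mon -> Prop).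

Lemma homrow0 j : homrow sh U j 0.
Proof. by move=> k u; rewrite mxE mcoeff0 eqxx. Qed.

Lemma homrowB j v v' : homrow sh U j v -> homrow sh U j v' -> homrow sh U j (v - v').
Proof.
move=> Hv Hw k u; rewrite !mxE mcoeffB => H.
have [E|] := eqVneq ((v 0 k)@_u) 0; last exact: Hv.
by apply: Hw; apply: contraNneq H => ->; rewrite E subr0.
Qed.

Lemma homrow_act z j v : (forall u, U u -> U (u + U_(z))%MM) ->
  homrow sh U j v -> homrow sh U j.+1 (xact z v).
Proof.
move=> HU Hv k u; rewrite xactE mcoeff_XM; case: ifPn => uz; first by rewrite eqxx.
move=> /Hv [E Uu]; rewrite -(submK (m := U_(z)) (m' := u)) ?lep1mP //; split; last exact: HU.
by rewrite mdegD mdeg1 -E; lia.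
Qed.

Lemma homrow_delta (V : mon -> Prop) y j v : (forall u, U (u + U_(y))%MM -> V u) ->
  homrow sh U j.+1 v -> homrow sh V j (rdelta y v).
Proof.
move=> HU Hv k u; rewrite rdeltaE mcoeff_pdelta => /Hv [].
rewrite mdegD mdeg1 => E /HU Vu; split=> //; lia.
Qed.

Lemma homrow_delta0 y v : homrow sh U 0 v -> rdelta y v = 0.
Proof.
move=> Hv; apply/rowP => k; rewrite rdeltaE mxE; apply/mpolyP => u; rewrite mcoeff_pdelta mcoeff0.
apply/eqP; apply: contraTT isT => /Hv []; rewrite mdegD mdeg1; lia.
Qed.

Lemma homrow_rho (V : mon -> Prop) y j v : (forall u, U u -> u y = 0%N -> V u) ->
  homrow sh U j v -> homrow sh V j (rrho y v).
Proof.
move=> HU Hv k u; rewrite rrhoE mcoeff_prho.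
case: (eqVneq (u y) 0%N) => [uy|_]; last by rewrite eqxx.
by move=> /Hv [E Uu]; split=> //; apply: HU.
Qed.

Lemma homrow_sub (V : mon -> Prop) j v : (forall u, U u -> V u) ->
  homrow sh U j v -> homrow sh V j v.
Proof. by move=> UV Hv k u /Hv [E /UV]. Qed.
End Homrow.

Lemma mcoeff_foldl_rho (l : seq 'I_n) (v : M) k u :
  (foldl (fun v y => rrho y v) v l 0 k)@_u =
  if all (fun y => u y == 0%N) l then (v 0 k)@_u else 0.
Proof.
elim: l v => //= y l IH v; rewrite IH rrhoE mcoeff_prho.
by case: (u y == 0%N); rewrite ?if_same.
Qed.

Lemma free_acyclic sh (l : seq 'I_n) (p j : nat) c : uniq l -> l =i 'I_n ->
  kin (homrow sh (fun=> True)) p j c -> @kd _ M xact l c = 0 ->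
  (p = 0%N -> forall k, (kbot c 0 k)@_0 = 0) ->
  exists2 b : kos M l, kin (homrow sh (fun=> True)) p.+1 j b & kd xact b = c.
Proof.
move=> ul lT Hc dc Hz; apply: (koszul_acyclic (rho := rrho) (delta := rdelta)) => //.
- exact: rrho_act.
- exact: rrho_delta.
- by move=> i; apply: homrow0.
- by move=> y i v; apply: homrow_rho.
- by move=> y i v; apply: homrow_delta.
- by move=> y v; apply: homrow_delta0.
- exact: rdelta_act.
move=> p0; apply/rowP => k; apply/mpolyP => u; rewrite mcoeff_foldl_rho mxE mcoeff0.
case: allP => // H; suff -> : u = 0%MM by apply: Hz.
by apply/mnmP => i; rewrite mnm0E; apply/eqP/H; rewrite lT.
Qed.

End Module.

Section MonomialRegularity.
Variable l : seq 'I_n.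

(* Monomial ideals are given by up-closed sets U of exponents; the homology of  *)
(* K(l; U) in degrees (p, j) is Tor_p(U, K)_j when l lists all the variables.   *)
Definition mreg (U : mon -> Prop) (s : nat) : Prop :=
  forall p j : nat, (s + p < j)%N ->
  vanish (@xact 1) (homrow (fun=> 0%N) U) l p j.

Definition upclosed (U : mon -> Prop) := forall u w, U u -> U (u + w)%MM.

(* Composing with [mres y] yields the ideal generated by the monomials of U that *)
(* do not involve y, which stands for U + (y).                                  *)
Definition mres (y : 'I_n) (u : mon) : mon :=
  [multinom if i == y then 0%N else u i | i < n].

Lemma mreg_ext U V s : (forall u, U u <-> V u) -> mreg U s -> mreg V s.
Proof.
move=> UV HU p j Hj; apply: vanish_eq (HU p j Hj) => i v.
by split; apply: homrow_sub => u /UV.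
Qed.

Lemma mreg_mono U s t : (s <= t)%N -> mreg U s -> mreg U t.
Proof. by move=> st HU p j Hj; apply: HU; lia. Qed.

Lemma mres_id y u : u y = 0%N -> mres y u = u.
Proof. by move=> uy; apply/mnmP => i; rewrite mnmE; case: eqP => // ->. Qed.

Lemma mresD y u w : mres y (u + w)%MM = (mres y u + mres y w)%MM.
Proof. by apply/mnmP => i; rewrite !(mnmE, mnmDE); case: eqP. Qed.

Lemma mresU y : mres y U_(y)%MM = 0%MM.
Proof. by apply/mnmP => i; rewrite !(mnmE, mnm0E, mnm1E) eq_sym; case: eqP. Qed.

Lemma mres_le y u : u = (mres y u + (u - mres y u))%MM.
Proof. by apply/mnmP => i; rewrite !(mnmE, mnmDE, mnmBE); case: eqP; lia. Qed.

Lemma upclosed_mres y U : upclosed U -> upclosed (fun u => U (mres y u)).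
Proof. by move=> HU u w Hu; rewrite mresD; apply: HU. Qed.

Lemma upclosed_colon w U : upclosed U -> upclosed (fun u => U (u + w)%MM).
Proof. by move=> HU u v Hu; rewrite -addmA [(v + w)%MM]addmC addmA; apply: HU. Qed.

(** The colon ideal enters through multiplication by y, of degree 1; hence its bound is one smaller
    than the others. *)
Lemma mreg_colon y U t : upclosed U -> mreg (fun u => U (u + U_(y))%MM) t ->
  mreg (fun u => U (mres y u)) t.+1 -> mreg U t.+1.
Proof.
move=> HU HC HE p [|j] // Hj.
apply: (vanish_colon (@xactC 1) (y := y) (@rdelta_act 1 y) (@rrho_delta 1 y)
  (E := homrow (fun=> 0%N) (fun u => U (mres y u)))
  (C := homrow (fun=> 0%N) (fun u => U (u + U_(y))%MM))).
- by move=> i; apply: homrow0.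
- by move=> i a b; apply: homrowB.
- by move=> i; apply: homrow0.
- by move=> i a b; apply: homrowB.
- by move=> i; apply: homrow0.
- by move=> i a b; apply: homrowB.
- by move=> z i v; apply: homrow_act => u; apply: upclosed_mres.
- by move=> i v; apply: homrow_delta => u; rewrite mresD mresU addm0.
- by move=> v; apply: homrow_delta0.
- by move=> i v; apply: homrow_rho => u Hu uy; rewrite mres_id.
- by move=> i v; apply: homrow_delta.
- by move=> v; apply: homrow_delta0.
- move=> i v Hv k u; rewrite xactE mcoeff_XM; case: ifPn => uz; first by rewrite eqxx.
  move=> /Hv [E]; rewrite submK ?lep1mP // => Uu; split=> //.
  by rewrite -(submK (m := U_(y)) (m' := u)) ?lep1mP // mdegD mdeg1; lia.
- by move=> i v; apply: homrow_sub => u Hu; rewrite (mres_le y u); apply: HU.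
- by move=> i v; apply: homrow_sub => u Hu; rewrite (mres_le y u) -addmA; apply: HU.
- by apply: HC; lia.
- exact: HE.
by case: p Hj => // p Hj; apply: HE; lia.
Qed.

Lemma mreg_empty U s : (forall u, ~ U u) -> mreg U s.
Proof.
move=> U0 p j Hj c Hc dc; exists 0; first by apply: kin0 => i; apply: homrow0.
suff -> : c = 0 by rewrite raddf0.
have H i v : @homrow 1 (fun=> 0%N) U i v -> v = 0.
  move=> Hv; apply/rowP => k; rewrite mxE; apply/mpolyP => u; rewrite mcoeff0.
  by apply/eqP; apply: contraTT isT => /Hv [_ /U0].
elim: (l) p j c Hc {dc Hj} => [|z l' IH] p j; first by case: p => [|p] c //= /H.
move=> [a b] /= [/IH -> Hb]; case: p j Hb => [|p] [|j]; try by move=> ->.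
by move=> /IH ->.
Qed.

Hypotheses (l_uniq : uniq l) (l_full : l =i 'I_n).

Lemma mreg_restrict y U s : upclosed U -> mreg U s -> mreg (fun u => U (mres y u)) s.
Proof.
move=> HU HR p j Hj.
apply: (vanish_retract (@rrho_act 1 y) (@rdelta_act 1 y) (@rrho_delta 1 y)
  (D := homrow (fun=> 0%N) U)); rewrite ?l_full //; last exact: HR.
- by move=> i; apply: homrow0.
- by move=> i a b; apply: homrowB.
- by move=> i v; apply: homrow_delta => u; rewrite mresD mresU addm0.
- by move=> v; apply: homrow_delta0.
- by move=> i v; apply: homrow_sub => u Hu; rewrite (mres_le y u); apply: HU.
- by move=> i v; apply: homrow_rho => u Hu uy; rewrite mres_id.
- by move=> i; apply: homrow0.
Qed.

Lemma mreg_full U s : (forall u, U u) -> mreg U s.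
Proof.
move=> UT; apply: (@mreg_ext (fun=> True)) => // p j Hj c Hc dc.
apply: free_acyclic => // p0 k; move: Hc; rewrite p0 => Hc.
have {}Hc : homrow (fun=> 0%N) (fun=> True) j (kbot c).
  by elim: (l) c Hc {dc} => //= z l' IH c [/IH].
apply/eqP; apply: contraTT isT => /Hc [] ; rewrite mdeg0; lia.
Qed.

End MonomialRegularity.
End Rows.

(** * Colon ideals of powers of edge ideals *)

Section EdgeProducts.
Local Open Scope nat_scope.
Variables (n : nat) (e : rel 'I_n).
Hypothesis e_sym : ssrbool.symmetric e.
Local Notation mon := 'X_{1..n}.
Implicit Types (A : {set 'I_n}) (u v w : mon) (M : seq ('I_n * 'I_n)) (x y z : 'I_n).

(* u is a multiple of a product of q edges with both ends in A. *)
Fixpoint emul A (q : nat) u : Prop :=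
  if q is q'.+1 then
    exists x y v, [/\ x \in A, y \in A, e x y, u = (U_(x) + U_(y) + v)%MM & emul A q' v]
  else True.

Definition edge_in A (b : 'I_n * 'I_n) := [&& b.1 \in A, b.2 \in A & e b.1 b.2].

Definition emon M : mon := \big[mnm_add/0%MM]_(b <- M) (U_(b.1) + U_(b.2))%MM.

Lemma emon_cons b M : emon (b :: M) = (U_(b.1) + U_(b.2) + emon M)%MM.
Proof. by rewrite /emon big_cons. Qed.

Lemma emul_up A q : upclosed (emul A q).
Proof.
elim: q => [|q IH] //= u w [x [y [v [xA yA xy -> Hv]]]].
exists x, y, (v + w)%MM; split=> //; last exact: IH.
by rewrite addmA.
Qed.

Lemma emulS A q u : emul A q.+1 u -> emul A q u.
Proof. by move=> [x [y [v [_ _ _ -> Hv]]]]; rewrite addmC; apply: emul_up. Qed.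

Lemma emul_emon A M q u : all (edge_in A) M -> emul A q u ->
  emul A (size M + q) (emon M + u)%MM.
Proof.
elim: M => [|[a b] M IH] /=; first by rewrite /emon big_nil add0m.
move=> /andP[/and3P[/= aA bA ab] HM] Hu; exists a, b, (emon M + u)%MM; split=> //.
  by rewrite emon_cons addmA.
exact: IH.
Qed.

Lemma mdeg_emon M : mdeg (emon M) = (2 * size M)%N.
Proof.
elim: M => [|b M IH]; first by rewrite /emon big_nil mdeg0.
by rewrite emon_cons !mdegD !mdeg1 IH /=; lia.
Qed.

Lemma emul_exact A k u : emul A k u -> mdeg u = (2 * k)%N ->
  exists M, [/\ all (edge_in A) M, size M = k & emon M = u].
Proof.
elim: k u => [|k IH] u /=.
  move=> _ /eqP; rewrite muln0 mdeg_eq0 => /eqP ->; exists [::]; split=> //.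
  by rewrite /emon big_nil.
move=> [x [y [v [xA yA xy -> Hv]]]]; rewrite !mdegD !mdeg1 => E.
have [|M [HM sM eM]] := IH v Hv; first by lia.
by exists ((x, y) :: M); split; rewrite /= ?emon_cons ?eM ?sM //= /edge_in /= xA yA xy.
Qed.

Lemma emul_token A q w x : emul A q (w + U_(x))%MM ->
  emul A q w \/ exists y w', [/\ x \in A, y \in A, e x y, w = (U_(y) + w')%MM & emul A q.-1 w'].
Proof.
elim: q w => [|q IH] w; first by left.
move=> [a [b [v [aA bA ab E Hv]]]].
have [ax|ax] := eqVneq a x.
  right; exists b, v; split=> //=; rewrite -?ax //.
  by apply/(@addmI _ U_(x)%MM); rewrite addmC E ax addmA.
have [bx|bx] := eqVneq b x.
  right; exists a, v; split=> //=; rewrite -?bx // 1?e_sym //.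
  apply/(@addmI _ U_(x)%MM); rewrite addmC E bx; apply/mnmP => i; rewrite !mnmDE; clear; lia.
have vx : v x != 0%N.
  move/mnmP/(_ x): E; rewrite !mnmDE !mnm1E eqxx (negPf ax) (negPf bx); lia.
have {}E : w = (U_(a) + U_(b) + (v - U_(x)))%MM.
  apply/(@addIm _ U_(x)%MM); rewrite E; apply/mnmP => i; rewrite !mnmDE mnmBE !mnm1E.
  by case: (eqVneq x i) vx => [->|_] vx; lia.
have [|H|[y [w' [xA yA xy Ev H]]]] := IH (v - U_(x))%MM.
- by rewrite submK // lep1mP.
- by left; exists a, b, (v - U_(x))%MM; split.
case: q {IH Hv} H => [|q] /= H; first by left; exists a, b, (v - U_(x))%MM.
right; exists y, (U_(a) + U_(b) + w')%MM; split=> //.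
  by rewrite E Ev; apply/mnmP => i; rewrite !mnmDE; clear; lia.
by exists a, b, w'; split.
Qed.

Lemma emul_remove A q w x : emul A q.+1 (w + U_(x))%MM -> emul A q w.
Proof.
move=> /emul_token[/emulS //|[y [w' [_ _ _ -> H]]]].
by rewrite addmC; apply: emul_up.
Qed.

Lemma emon_split A M b : b \in M -> all (edge_in A) M -> exists M',
  [/\ emon M = (U_(b.1) + U_(b.2) + emon M')%MM, all (edge_in A) M',
      size M = (size M').+1, edge_in A b & {subset M' <= M}].
Proof.
move=> bM HM; have P := perm_to_rem bM; exists (rem b M).
have HM' : all (edge_in A) (b :: rem b M) by rewrite -(perm_all _ P).
case/andP: HM' => Hb HM'; split=> //.
- by rewrite -emon_cons /emon; apply: perm_big.
- by rewrite (perm_size P).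
exact: mem_rem.
Qed.

Lemma emon_supp M y : emon M y != 0%N -> exists2 b, b \in M & (b.1 == y) || (b.2 == y).
Proof.
elim: M => [|b M IH]; first by rewrite /emon big_nil mnm0E.
rewrite emon_cons !mnmDE !mnm1E => H.
have [E|E] := boolP ((b.1 == y) || (b.2 == y)); first by exists b; rewrite ?mem_head.
case: IH => [|c cM Hc]; last by exists c; rewrite // inE cM orbT.
by move: H; move: E; rewrite negb_or => /andP[/negPf -> /negPf ->].
Qed.

(* An alternating path from x along the edges of M leads to a free variable z. *)
Lemma emul_exchange A M x q u : all (edge_in A) M -> emul A q (u + U_(x) + emon M)%MM ->
  emul A q (u + emon M)%MM \/
  exists2 z, u z != 0%N & emul A (size M).+1 (U_(z) + U_(x) + emon M)%MM.
Proof.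
elim: {M}(size M) {-2}M (erefl (size M)) x q => [|k IH] M sM x q HM.
  move/size0nil: sM HM => -> _; rewrite /emon big_nil !addm0 => /emul_token[|]; first by left.
  move=> [y [w [xA yA xy -> _]]]; right; exists y; first by rewrite mnmDE mnm1E eqxx.
  by exists y, x, 0%MM; rewrite addm0 e_sym.
rewrite -addmA [(U_(x) + _)%MM]addmC addmA => /emul_token[|]; first by left.
move=> [y [w [xA yA xy E H]]].
have [uy|uy] := boolP (u y != 0%N).
  right; exists y => //; rewrite -addn1 addmC.
  apply: emul_emon => //; exists y, x, 0%MM; rewrite addm0 e_sym; split=> //.
(* Since y does not divide u, it lies on an edge y c of M. Trading y c for x y frees c, and the path
   continues from c with the remaining edges M'. *)
have /emon_supp[b bM Hb] : emon M y != 0%N.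
  move/mnmP/(_ y): E; rewrite !mnmDE mnm1E eqxx; lia.
have [M' [eM HM' sM' /and3P[b1 b2 be] _]] := emon_split bM HM.
have [c [cA yc {}eM]] : exists c, [/\ c \in A, e y c & emon M = (U_(y) + U_(c) + emon M')%MM].
  case/orP: Hb => /eqP <-; [exists b.2 | exists b.1]; split=> //; first by rewrite e_sym.
  by rewrite eM [(U_(b.1) + _)%MM]addmC.
have {}sM' : size M' = k by move: sM; rewrite sM' => -[].
have Ew : w = (u + U_(c) + emon M')%MM.
  apply/(@addmI _ U_(y)%MM); rewrite -E eM; apply/mnmP => i; rewrite !mnmDE; clear; lia.
case: q H => [|q] H; first by left.
rewrite Ew in H; have [H1|[z uz Hz]] := IH _ sM' _ _ HM' H.
  left; exists y, c, (u + emon M')%MM; split=> //.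
  by rewrite eM; apply/mnmP => i; rewrite !mnmDE; clear; lia.
(* The path is rerouted by z x M = (x y) (z c M'). *)
right; exists z => //; exists x, y, (U_(z) + U_(c) + emon M')%MM.
split=> //; last by rewrite sM -sM'.
by rewrite eM; apply/mnmP => i; rewrite !mnmDE; clear; lia.
Qed.

Lemma emul_within A (B : {set 'I_n}) q u : emul A q u ->
  (forall x y, x \in A -> y \in A -> e x y -> u x != 0%N -> u y != 0%N -> x \in B /\ y \in B) ->
  emul B q u.
Proof.
elim: q u => //= q IH u [x [y [v [xA yA xy E Hv]]]] H.
have [xB yB] : x \in B /\ y \in B.
  by apply: H => //; rewrite E !mnmDE !mnm1E eqxx; lia.
exists x, y, v; split=> //; apply: IH => // a b aA bA ab va vb.
by apply: H => //; rewrite E !mnmDE; lia.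
Qed.

Lemma emul_sub A (B : {set 'I_n}) q u : A \subset B -> emul A q u -> emul B q u.
Proof.
by move=> /subsetP AB Hu; apply: (emul_within Hu) => x y xA yA _ _ _; split; apply: AB.
Qed.

Lemma edge_in_sub A (B : {set 'I_n}) M : {in M, forall b, (b.1 \in B) && (b.2 \in B)} ->
  all (edge_in A) M -> all (edge_in B) M.
Proof.
move=> HB /allP HA; apply/allP => b bM.
by case/and3P: (HA b bM) (HB b bM) => _ _ be /andP[? ?]; apply/and3P.
Qed.

Lemma emon_split_at A M x : all (edge_in A) M -> has (fun b => (b.1 == x) || (b.2 == x)) M ->
  exists y M', [/\ [/\ x \in A, y \in A & e x y], emon M = (U_(x) + U_(y) + emon M')%MM,
     all (edge_in A) M' & size M = (size M').+1].
Proof.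
move=> HM /hasP[b bM Hb]; have [M' [eM HM' sM' /and3P[b1 b2 be] _]] := emon_split bM HM.
case/orP: Hb => /eqP <-; [exists b.2, M' | exists b.1, M'].
  by split.
by rewrite e_sym [(U_(b.2) + _)%MM]addmC; split.
Qed.

End EdgeProducts.

(** * Colons along a set of variables, and the bound for colons by products of edges *)

Section IteratedColon.
Local Open Scope nat_scope.
Variables (K : fieldType) (n : nat) (l : seq 'I_n).
Hypotheses (l_uniq : uniq l) (l_full : l =i 'I_n).
Local Notation mon := 'X_{1..n}.
Local Notation mreg := (@mreg K n l).

Definition mress (Z : seq 'I_n) (u : mon) : mon :=
  [multinom if i \in Z then 0%N else u i | i < n].

Lemma mress_off Z u z : z \in Z -> mress Z u z = 0%N.
Proof. by move=> zZ; rewrite mnmE zZ. Qed.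

Lemma mress_cons z Z u : mress (z :: Z) u = mres z (mress Z u).
Proof. by apply/mnmP => i; rewrite !mnmE inE; case: eqP. Qed.

Lemma mress_consr z Z u : mress (z :: Z) u = mress Z (mres z u).
Proof. by apply/mnmP => i; rewrite !mnmE inE; case: eqP => //; rewrite if_same. Qed.

Lemma mreg_restricts Z U s : upclosed U -> mreg U s -> mreg (fun u => U (mress Z u)) s.
Proof.
move=> Uup HU; elim: Z => [|z Z IH].
  by apply: mreg_ext HU => u; rewrite (_ : mress _ u = u) //; apply/mnmP => i; rewrite mnmE.
have up : upclosed (fun u => U (mress Z u)).
  move=> u w Hu; rewrite (_ : mress Z _ = mress Z u + mress Z w)%MM; first exact: Uup.
  by apply/mnmP => i; rewrite !(mnmDE, mnmE); case: ifP.
apply: mreg_ext (mreg_restrict l_uniq l_full (y := z) up IH) => u.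
by rewrite -mress_consr.
Qed.

(** Iterates [mreg_colon]. After z is set to zero the remaining colons must still be bounded, which
    [mreg_restrict] ensures. *)
Lemma mreg_colons Z U t : uniq Z -> upclosed U ->
  (forall z, z \in Z -> mreg (fun u => U (u + U_(z))%MM) t) ->
  mreg (fun u => U (mress Z u)) t.+1 -> mreg U t.+1.
Proof.
elim: Z U => [|z Z IH] U.
  move=> _ _ _; apply: mreg_ext => u.
  by rewrite (_ : mress _ u = u) //; apply/mnmP => i; rewrite mnmE.
move=> /andP[zZ uZ] Uup HZ HR; apply: (mreg_colon (y := z)) => //.
  by apply: HZ; rewrite mem_head.
apply: IH => //; first exact: upclosed_mres.
- move=> y yZ; have zy : z != y by apply: contraNneq zZ => ->.
  have Hy : mreg (fun u => U (u + U_(y))%MM) t by apply: HZ; rewrite inE yZ orbT.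
  apply: mreg_ext (mreg_restrict l_uniq l_full (y := z) (upclosed_colon Uup) Hy) => u.
  rewrite mresD [mres z U_(y)%MM]mres_id //.
  by rewrite mnm1E eq_sym (negPf zy).
by apply: mreg_ext HR => u; rewrite mress_cons.
Qed.

(** Only agreement off Z is asked of V, so that V can be a colon ideal for fewer edges or for a
    smaller vertex set. *)
Lemma mreg_colons_off Z (U V : mon -> Prop) t : uniq Z -> upclosed U -> upclosed V ->
  (forall z, z \in Z -> mreg (fun u => U (u + U_(z))%MM) t) ->
  (forall u : mon, (forall z, z \in Z -> u z = 0%N) -> U u <-> V u) ->
  mreg V t.+1 -> mreg U t.+1.
Proof.
move=> uZ Uup Vup HZ UV HV; apply: (mreg_colons uZ Uup HZ).
apply: mreg_ext (mreg_restricts (Z := Z) Vup HV) => u.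
by apply: iff_sym; apply: UV => z; apply: mress_off.
Qed.

Lemma classical_set (P : 'I_n -> Prop) : exists Z : {set 'I_n}, forall z, z \in Z <-> P z.
Proof.
exists [set z | if excluded_middle_informative (P z) then true else false] => z.
by rewrite inE; case: excluded_middle_informative.
Qed.

Variable e : rel 'I_n.
Hypothesis e_sym : ssrbool.symmetric e.
(** Stands for the regularity of the edge ideal on A. It is kept abstract because g(A) = |A| + 1 is
    needed too, before [reg] is known to be meaningful. *)
Variable g : {set 'I_n} -> nat.
Hypothesis g_gt0 : forall A, (0 < g A)%N.
Hypothesis g_delete : forall A x, (g (A :\ x) <= g A)%N.
Hypothesis g_special : forall A : {set 'I_n},
  (exists x y, [/\ x \in A, y \in A & e x y]) ->
  exists2 x, x \in A & (g (A :\: (x |: [set y | e x y])) + 1 <= g A)%N.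

(* Colons by products of edges are bounded simultaneously, by induction on A,   *)
(* then on the remaining power d, then on the number of edges in M.  A special  *)
(* vertex x off M is handled by J : x and J + (x).  If M = (x y) M', one takes  *)
(* colons by the variables z such that z y M' is a product of edges.  In both   *)
(* cases J : x, for x special, is treated by the colons by those z such that    *)
(* z x M is a product of edges.                                                 *)
Theorem mreg_colon_edges (A : {set 'I_n}) (d : nat) (M : seq ('I_n * 'I_n)) :
  all (edge_in e A) M ->
  mreg (fun u => emul e A (size M + d) (u + emon M)%MM) (2 * d + g A - 2).
Proof.
have [N leN] := ubnP #|A|; elim: N A leN d M => // N IHN A leN.
elim=> [|d IHd] M HM.
  apply: mreg_full => // u; rewrite addmC; exact: emul_emon.
have [edgeA|no_edge] := classic (exists x y, [/\ x \in A, y \in A & e x y]); last first.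
  apply: mreg_empty => u; rewrite addnS => -[x [y [v [xA yA xy _ _]]]].
  by apply: no_edge; exists x, y.
have up q w : upclosed (fun u => emul e A q (u + w)%MM) by exact: upclosed_colon (@emul_up _ e A q).
have [x xA gx] := g_special edgeA.
set H := A :\: (x |: [set y | e x y]) in gx.
(* With [gx] this yields g(A) >= 2, so that the truncated subtraction in 2d + g(A) - 2 is exact. *)
have gH := g_gt0 H.
have ltH : (#|H| < N)%N.
  have pH : H \proper A.
    by apply/properP; split; [apply: subsetDl | exists x; rewrite // !inE eqxx].
  by have := proper_card pH; move: leN; clear; lia.
(* If z x M1 is a product M2 of |M1| + 1 edges, the colon by x M1 and then z is the colon by M2 with
   d left over, bounded by [IHd]. Off all such z, V takes over. *)
have colon_step M1 (V : mon -> Prop) : all (edge_in e A) M1 -> upclosed V ->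
    (forall u : mon, (forall z, emul e A (size M1).+1 (U_(z) + U_(x) + emon M1)%MM -> u z = 0%N) ->
       emul e A (size M1 + d.+1) (u + (U_(x) + emon M1))%MM <-> V u) ->
    mreg V (2 * d + g A - 2).+1 ->
    mreg (fun u => emul e A (size M1 + d.+1) (u + (U_(x) + emon M1))%MM) (2 * d + g A - 2).+1.
  move=> HM1 upV UV HV.
  have [Z HZ] := classical_set (fun z => emul e A (size M1).+1 (U_(z) + U_(x) + emon M1)%MM).
  apply: (mreg_colons_off (enum_uniq Z) (up _ _) upV _ _ HV) => [z|u Hu]; last first.
    by apply: UV => z /HZ zZ; apply: Hu; rewrite mem_enum.
  rewrite mem_enum => /HZ Hz.
  have [|M2 [HM2 sM2 eM2]] := emul_exact Hz.
    by rewrite !mdegD !mdeg1 mdeg_emon; clear; lia.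
  by apply: mreg_ext (IHd M2 HM2) => u; rewrite sM2 addnS eM2 !addmA.
have colon_x M1 : all (edge_in e A) M1 ->
    mreg (fun u => emul e A (size M1 + d.+1) (u + (U_(x) + emon M1))%MM) (2 * d + g A - 2).+1.
  have [k] := ubnP (size M1); elim: k M1 {M HM} => // k IHk M ltk HM.
  have exch (u : mon) : (forall z, emul e A (size M).+1 (U_(z) + U_(x) + emon M)%MM -> u z = 0%N) ->
      emul e A (size M + d.+1) (u + (U_(x) + emon M))%MM ->
      emul e A (size M + d.+1) (u + emon M)%MM.
    by move=> Hu; rewrite addmA => /(emul_exchange e_sym HM)[//|[z uz /Hu E]]; rewrite E in uz.
  have [hasN|hasN] := boolP (has (fun b => e x b.1 || e x b.2) M).
    (* Here M = a c M' with a adjacent to x, and off the variables z the edge a c cancels: removing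
       a costs one edge, and an exchange at c yielding z c M' would make z x M = (x a) (z c M') a
       product of edges. *)
    have [a [xa hasa]] : exists a, e x a /\ has (fun b => (b.1 == a) || (b.2 == a)) M.
      case/hasP: hasN => b bM /orP[xb|xb]; [exists b.1 | exists b.2]; split=> //;
        by apply/hasP; exists b; rewrite ?eqxx ?orbT.
    have [c [M' [[aA cA ac] eM HM' sM']]] := emon_split_at e_sym HM hasa.
    apply: (colon_step _ (fun u => emul e A (size M' + d.+1) (u + (U_(x) + emon M'))%MM)) => //.
      move=> u Hu; split=> [/(exch _ Hu)|H1].
        rewrite sM' addSn eM (_ : u + _ = u + U_(c) + emon M' + U_(a))%MM; last first.
          by apply/mnmP => i; rewrite !mnmDE; clear; lia.
        move=> /(emul_remove e_sym) /(emul_exchange e_sym HM')[Hc|[z uz Hz]].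
          by rewrite [(U_(x) + _)%MM]addmC addmA; apply: emul_up.
        have E := Hu z; rewrite E in uz => //.
        rewrite sM'; exists x, a, (U_(z) + U_(c) + emon M')%MM; split=> //.
        by rewrite eM; apply/mnmP => i; rewrite !mnmDE; clear; lia.
      rewrite sM'; exists a, c, (u + (U_(x) + emon M'))%MM; split=> //.
      by rewrite eM; apply/mnmP => i; rewrite !mnmDE; clear; lia.
    by apply: IHk => //; rewrite -ltnS -sM'.
  (* No end of M is adjacent to x, hence none equals x. Neighbours of x in A are among the z, since
     x z is an edge, so they do not divide u either: all edges of A inside u M lie in H. *)
  have MH : all (edge_in e H) M.
    apply: (edge_in_sub _ HM) => b bM; move/hasPn/(_ b bM): hasN; rewrite negb_or => /andP[n1 n2].
    have /and3P[b1 b2 be] := allP HM b bM.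
    rewrite !inE b1 b2 (negPf n1) (negPf n2) !orbF !andbT; apply/andP; split.
      by apply: contraNneq n2 => <-.
    by apply: contraNneq n1 => <-; rewrite e_sym.
  apply: (colon_step _ (fun u => emul e H (size M + d.+1) (u + emon M)%MM)) => //.
  - exact: upclosed_colon (@emul_up _ e H _).
  - move=> u Hu; split=> [/(exch _ Hu) H1|H1]; last first.
      rewrite [(U_(x) + _)%MM]addmC addmA; apply: emul_up.
      by apply: emul_sub H1; apply: subsetDl.
    have far p : p \in A -> (u + emon M)%MM p != 0%N -> ~~ e x p.
      move=> pA; apply: contraNN => xp; rewrite mnmDE.
      have -> : u p = 0%N.
        apply: Hu; rewrite -addn1 addmC; apply: emul_emon => //; exists p, x, 0%MM.
        by rewrite e_sym addm0.
      apply/negPn/negP => /emon_supp[b bM /orP[]/eqP E]; move/hasPn/(_ b bM): hasN;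
      by rewrite E xp ?orbT.
    apply: (emul_within H1) => p r pA rA pr up1 ur.
    have fp := far p pA up1; have fr := far r rA ur.
    rewrite !inE pA rA (negPf fp) (negPf fr) !orbF !andbT; split.
      by apply: contraNneq fr => <-.
    by apply: contraNneq fp => <-; rewrite e_sym.
  (* By g(H) + 1 <= g(A), the bound 2 (d + 1) + g(H) - 2 is at most (2d + g(A) - 2) + 1. *)
  apply: mreg_mono (IHN H ltH d.+1 M MH); move: gx gH; clear; lia.
have bound : (2 * d.+1 + g A - 2 = (2 * d + g A - 2).+2)%N by move: gH gx; clear; lia.
rewrite bound; have [k] := ubnP (size M); elim: k M HM => // k IHk M HM ltk.
have [hasx|hasNx] := boolP (has (fun b => (b.1 == x) || (b.2 == x)) M).
  (* Off the z for which z y M' is a product of edges, the edge x y cancels and M' takes the place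
     of M. For such z, z M = x (z y M') and [colon_x] applies. *)
  have [y [M' [[_ yA xy] eM HM' sM']]] := emon_split_at e_sym HM hasx.
  have [Z HZ] := classical_set (fun z => emul e A (size M) (U_(z) + U_(y) + emon M')%MM).
  apply: (mreg_colons_off (enum_uniq Z) (up _ _) (up _ _) _ _ (IHk M' HM' _)); last first.
  - by rewrite -ltnS -sM'.
  - move=> u Hu; split=> [|H1]; last first.
      rewrite sM'; exists x, y, (u + emon M')%MM; split=> //.
      by rewrite eM; apply/mnmP => i; rewrite !mnmDE; clear; lia.
    rewrite sM' addSn eM (_ : u + _ = u + U_(y) + emon M' + U_(x))%MM; last first.
      by apply/mnmP => i; rewrite !mnmDE; clear; lia.
    move=> /(emul_remove e_sym) /(emul_exchange e_sym HM')[//|[z uz]].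
    by rewrite -sM' => /HZ zZ; rewrite Hu ?mem_enum in uz.
  move=> z; rewrite mem_enum => /HZ Hz.
  have [|M2 [HM2 sM2 eM2]] := emul_exact Hz.
    by rewrite !mdegD !mdeg1 mdeg_emon sM'; clear; lia.
  apply: mreg_ext (colon_x M2 HM2) => u; rewrite sM2 eM2 eM.
  rewrite (_ : u + (U_(x) + _) = u + U_(z) + (U_(x) + U_(y) + emon M'))%MM //.
  by apply/mnmP => i; rewrite !mnmDE; clear; lia.
apply: (mreg_colon (y := x)) => //.
  by apply: mreg_ext (colon_x M HM) => u; rewrite addmA.
have MAx : all (edge_in e (A :\ x)) M.
  apply: (edge_in_sub _ HM) => b bM; move/hasPn/(_ b bM): hasNx; rewrite negb_or => /andP[n1 n2].
  by have /and3P[b1 b2 be] := allP HM b bM; rewrite !inE b1 b2 n1 n2.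
have ltx : (#|A :\ x| < N)%N.
  by move: leN; rewrite (cardsD1 x A) xA; clear; lia.
have := IHN (A :\ x) ltx d.+1 M MAx => /(mreg_mono (t := (2 * d + g A - 2).+2)) Hx.
have {}Hx := mreg_restrict l_uniq l_full (y := x) (upclosed_colon (@emul_up _ e _ _)) (Hx _).
apply: mreg_ext (Hx _) => [u|]; last by move: (g_delete A x) gx gH; clear; lia.
split=> [|H1]; first by apply: emul_sub; apply: subsetDl.
apply: (emul_within H1) => p r pA rA pr up1 ur.
suff xn : (mres x u + emon M)%MM x = 0%N.
  rewrite !inE pA rA !andbT.
  by split; [apply: contraNneq up1 => -> | apply: contraNneq ur => ->]; rewrite xn.
rewrite mnmDE mnmE eqxx; apply/eqP/negPn/negP => /emon_supp[b bM Hb].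
by move/hasPn/(_ b bM): hasNx; rewrite Hb.
Qed.

End IteratedColon.

(** * Graded free resolutions and Koszul homology *)

Section BottomComponent.
Variables (T : eqType).

Fixpoint kemb (M : zmodType) (l : seq T) (m : M) : kos M l :=
  if l is _ :: l' then (kemb l' m, 0) else m.

Lemma kin_emb (M : zmodType) (D : nat -> M -> Prop) l j m :
  (forall i, D i 0) -> D j m -> kin D 0 j (kemb l m).
Proof. by move=> D0 Hm; elim: l => //= z l IH; split. Qed.

Lemma kbot_emb (M : zmodType) l (m : M) : @kbot T M l (kemb l m) = m.
Proof. by elim: l. Qed.

Lemma kbot_in (M : zmodType) (D : nat -> M -> Prop) l j (c : kos M l) :
  kin D 0 j c -> D j (@kbot T M l c).
Proof. by elim: l c => //= z l IH [a b] /= [/IH]. Qed.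

(** The bottom component of a boundary is a sum of multiples of the variables: H_0 is M modulo
    those. *)
Lemma kbot_kd (M : zmodType) (act : T -> {additive M -> M}) (G : M -> Prop) l (b : kos M l) :
  G 0 -> (forall x y, G x -> G y -> G (x + y)) -> (forall z m, G (act z m)) ->
  G (@kbot T M l (kd act b)).
Proof.
move=> G0 GD Gact; elim: l b => //= z l IH [a b] /=.
suff -> : kbot (kd act a + kmap (act z) b) = kbot (kd act a) + kbot (kmap (act z) b).
  by apply: GD => //; rewrite kbot_kmap.
by elim: (l) (kd act a) (kmap (act z) b) => //= y l' IHl x x'; rewrite IHl.
Qed.
End BottomComponent.

Section GradedMatrices.
Variables (K : fieldType) (n : nat).
Local Notation S := {mpoly K[n]}.
Local Notation mon := 'X_{1..n}.
Local Notation free sh := (homrow sh (fun=> True)).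

Definition hpoly (d j : nat) (p : S) := forall u, p@_u != 0 -> (mdeg u + d)%N = j.

Lemma hpolyD d j p q : hpoly d j p -> hpoly d j q -> hpoly d j (p + q).
Proof.
move=> Hp Hq u; rewrite mcoeffD; have [->|/Hp //] := eqVneq p@_u 0.
by rewrite add0r; apply: Hq.
Qed.

Lemma hpoly0 d j : hpoly d j 0.
Proof. by move=> u; rewrite mcoeff0 eqxx. Qed.

Lemma hpolyM d e j p q : hpoly d j p -> hpoly e d q -> hpoly e j (p * q).
Proof.
move=> Hp Hq u; rewrite -mcoeff_msupp => /msuppM_le /allpairsP[[u1 u2] /= []].
rewrite !mcoeff_msupp => /Hp E1 /Hq E2 ->; rewrite mdegD; lia.
Qed.

Lemma hpoly_sum (I : Type) (r : seq I) d j (F : I -> S) :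
  (forall i, hpoly d j (F i)) -> hpoly d j (\sum_(i <- r) F i).
Proof. by move=> H; apply: big_ind => //; [apply: hpoly0 | apply: hpolyD]. Qed.

Lemma free_hpoly m (sh : 'I_m -> nat) j v : free sh j v <-> forall k, hpoly (sh k) j (v 0 k).
Proof. by split=> [H k u /H [] | H k u /H]. Qed.

Lemma hpoly_const d c : hpoly d d c%:MP.
Proof.
move=> u; rewrite mcoeffC; case: (eqVneq u 0%MM) => [->|_]; first by rewrite mdeg0.
by rewrite mulr0 eqxx.
Qed.

Lemma free_scale m (sh : 'I_m -> nat) d j p v : hpoly d j p -> free sh d v -> free sh j (p *: v).
Proof.
by move=> Hp /free_hpoly Hv; apply/free_hpoly => k; rewrite mxE; apply: hpolyM (Hv k).
Qed.

Section GradedMap.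
Variables (r m : nat) (sh' : 'I_r -> nat) (sh : 'I_m -> nat) (phi : 'M[S]_(r, m)).
Hypothesis phi_homog : forall k, free sh (sh' k) (row k phi).

Lemma free_mul j v : free sh' j v -> free sh j (v *m phi).
Proof.
move=> /free_hpoly Hv; apply/free_hpoly => k; rewrite mxE; apply: hpoly_sum => i.
have /free_hpoly/(_ k) := @phi_homog i; rewrite mxE; exact: hpolyM.
Qed.

Lemma mulmx_act (z : 'I_n) (v : 'rV[S]_r) : @xact K n r z v *m phi = @xact K n m z (v *m phi).
Proof. by rewrite /xact /= -scalemxAl. Qed.

End GradedMap.

Definition hcomp m (sh : 'I_m -> nat) (j : nat) (v : 'rV[S]_m) : 'rV[S]_m :=
  \row_k \sum_(u <- msupp (v 0 k) | (mdeg u + sh k == j)%N) (v 0 k)@_u *: 'X_[u].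

Lemma mcoeff_hcomp m (sh : 'I_m -> nat) j v k u :
  (hcomp sh j v 0 k)@_u = if (mdeg u + sh k == j)%N then (v 0 k)@_u else 0.
Proof.
rewrite mxE raddf_sum /= -(sum_coeff (fun u : mon => mdeg u + sh k == j)%N).
by apply: eq_bigr => w _; rewrite mcoeffZ mcoeffX.
Qed.

Lemma hcomp_free m (sh : 'I_m -> nat) j v : free sh j (hcomp sh j v).
Proof.
move=> k u; rewrite mcoeff_hcomp.
by case: (eqVneq (mdeg u + sh k)%N j) => // _; rewrite eqxx.
Qed.

Lemma hcomp_id m (sh : 'I_m -> nat) j v : free sh j v -> hcomp sh j v = v.
Proof.
move=> Hv; apply/rowP => k; apply/mpolyP => u; rewrite mcoeff_hcomp.
case: eqP => // H; apply/esym/eqP; apply: contraTT isT => /Hv [E]; by rewrite E in H.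
Qed.

Lemma hcomp_sum m (sh : 'I_m -> nat) v : exists N0, forall N, (N0 <= N)%N ->
  v = \sum_(j < N) hcomp sh j v.
Proof.
exists (\max_k (msize (v 0%R k) + sh k))%N => N HN; apply/rowP => k; apply/mpolyP => u.
rewrite summxE raddf_sum /=; have [E|E] := eqVneq (v 0 k)@_u 0.
  by rewrite E big1 // => j _; rewrite mcoeff_hcomp E if_same.
have ltN : (mdeg u + sh k < N)%N.
  apply: leq_trans HN; apply: leq_trans (leq_bigmax k).
  by rewrite ltn_add2r; apply: msize_mdeg_lt; rewrite mcoeff_msupp.
rewrite (bigD1 (Ordinal ltN)) //= mcoeff_hcomp eqxx big1 ?addr0 // => j.
by rewrite mcoeff_hcomp -val_eqE /= eq_sym => /negPf ->.
Qed.

Lemma hcomp_mul r m (sh' : 'I_r -> nat) (sh : 'I_m -> nat) (phi : 'M[S]_(r, m)) j v :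
  (forall k, free sh (sh' k) (row k phi)) -> hcomp sh j (v *m phi) = hcomp sh' j v *m phi.
Proof.
move=> Hphi; have [N0 /(_ (maxn N0 j.+1) (leq_maxl _ _))] := hcomp_sum sh' v.
set N := maxn _ _ => E; have ltj : (j < N)%N by rewrite /N leq_max leqnn orbT.
have F i : free sh i (hcomp sh' i v *m phi) by apply: (free_mul Hphi); apply: hcomp_free.
apply/rowP => k; apply/mpolyP => u; rewrite mcoeff_hcomp.
case: (eqVneq (mdeg u + sh k)%N j) => [Eu|Eu]; last first.
  by apply/esym/eqP; apply: contraNT Eu => /F [->].
rewrite {1}E mulmx_suml summxE raddf_sum /= (bigD1 (Ordinal ltj)) //= big1 ?addr0 // => i.
move=> ij; apply/eqP; apply: contraNT ij => /F [Ei _]; apply/eqP/val_inj => /=.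
by rewrite -Ei.
Qed.

Lemma hcomp0 m (sh : 'I_m -> nat) j : hcomp sh j 0 = 0.
Proof.
apply/rowP => k; apply/mpolyP => u; rewrite mcoeff_hcomp !mxE mcoeff0; by case: ifP.
Qed.

End GradedMatrices.

(** * Dimension shifting along covers by free modules *)

Section Resolution.
Variables (K : fieldType) (n : nat) (l : seq 'I_n).
Hypotheses (l_uniq : uniq l) (l_full : l =i 'I_n).
Local Notation S := {mpoly K[n]}.
Local Notation mon := 'X_{1..n}.
Local Notation free sh := (homrow sh (fun=> True)).

Section Cover.
Variables (r m : nat) (sh' : 'I_r -> nat) (phi : 'M[S]_(r, m)).
Variable Z : nat -> 'rV[S]_m -> Prop.
Hypothesis Z0 : forall j, Z j 0.
Hypothesis Z_in : forall j v, free sh' j v -> Z j (v *m phi).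
Hypothesis Z_sur : forall j z, Z j z -> exists2 v, free sh' j v & v *m phi = z.

Definition syz (j : nat) (v : 'rV[S]_r) : Prop := free sh' j v /\ v *m phi = 0.
Definition minimal_cover := forall j v, syz j v -> forall k, (v 0 k)@_0 = 0.

Let f : {additive 'rV[S]_r -> 'rV[S]_m} := mulmxr phi.

Let f_act z v : f (@xact K n r z v) = @xact K n m z (f v).
Proof. exact: mulmx_act. Qed.

Lemma cover_image p j : vanish (@xact K n r) syz l p j -> vanish (@xact K n m) Z l p.+1 j.
Proof.
apply: (vanish_image (@xactC K n r) (f := f) f_act (D := free sh')) => //.
- by move=> i; apply: homrow0.
- by move=> i x y; apply: homrowB.
- by move=> z i v; apply: homrow_act.
- by move=> c Hc dc; apply: free_acyclic.
Qed.

Lemma cover_image0 j : (forall k, (sh' k < j)%N) -> vanish (@xact K n m) Z l 0 j.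
Proof.
move=> ltj c Hc dc.
have [c1 Hc1 E] := kin_lift (f := f) (D := free sh') (raddf0 f) Z_sur Hc.
have [||b Hb db] := free_acyclic (p := 0) l_uniq l_full Hc1.
- exact: kd_kin0 Hc1.
- move=> _ k; apply/eqP; apply: contraTT isT => /(kbot_in Hc1) [].
  by rewrite mdeg0 add0n => Ek; move: (ltj k); rewrite Ek ltnn.
exists (kmap f b); last by rewrite (kd_map f_act) db.
by rewrite -[j]addn0; apply: kin_map Hb; rewrite ?raddf0 // => i v _; rewrite addn0; apply: Z_in.
Qed.

Hypothesis phi_min : minimal_cover.

(** Minimality matters for p = 0: a syzygy without constant terms bounds in the free module,
    although H_0 of the latter is not zero. *)
Lemma cover_kernel p j : vanish (@xact K n m) Z l p.+1 j -> vanish (@xact K n r) syz l p j.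
Proof.
apply: (vanish_kernel (@xactC K n r) (f := f) f_act (D := free sh')) => //.
- by move=> i; apply: homrow0.
- by move=> i x y; apply: homrowB.
- by move=> z i v; apply: homrow_act.
move=> c Hc dc; apply: free_acyclic => //; first by apply: kinK Hc => i; apply: homrow0.
by move=> p0 k; move: Hc; rewrite p0 => /kbot_in Hb; apply: (phi_min Hb).
Qed.

(** Nakayama: otherwise the k-th generator is the image of some w without constant terms, and e_k -
    w is a syzygy with constant term 1 at k. *)
Lemma cover_degree k : ~ vanish (@xact K n m) Z l 0 (sh' k).
Proof.
have Hd : free sh' (sh' k) (delta_mx 0 k : 'rV[S]_r).
  apply/free_hpoly => i; rewrite mxE eqxx /=; case: eqP => [->|_]; last exact: hpoly0.
  by rewrite -mpolyC1; apply: hpoly_const.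
move=> /(_ (kemb l ((delta_mx 0 k : 'rV[S]_r) *m phi))) [||b Hb db].
- by apply: kin_emb => //; apply: Z_in.
- apply: (@kd_kin0 _ _ _ Z); exact: kin_emb (Z_in Hd).
have [b1 Hb1 E1] := kin_lift (f := f) (D := free sh') (raddf0 f) Z_sur Hb.
pose w : 'rV[S]_r := kbot (kd (@xact K n r) b1).
have Hw : free sh' (sh' k) w.
  apply: (@kbot_in _ _ (free sh') l); apply: kd_kin => //.
  - by move=> i; apply: homrow0.
  - by move=> i x y; apply: homrowB.
  - by move=> z i v; apply: homrow_act.
have w0 : forall i, (w 0 i)@_0 = 0.
  apply: (@kbot_kd _ _ _ (fun w : 'rV[S]_r => forall i, (w 0 i)@_0 = 0)).
  - by move=> i; rewrite mxE mcoeff0.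
  - by move=> x y Hx Hy i; rewrite mxE mcoeffD Hx Hy addr0.
  - by move=> z v i; rewrite xactE mcoeff_XM mnm0E.
have Ew : w *m phi = delta_mx 0 k *m phi.
  have := f_equal (@kbot _ _ l) db; rewrite kbot_emb => <-.
  by rewrite -E1 (kd_map f_act) kbot_kmap.
have : syz (sh' k) (delta_mx 0 k - w).
  by split; [apply: homrowB | rewrite mulmxBl Ew subrr].
move=> /phi_min /(_ k); rewrite !mxE !eqxx mcoeffB w0 subr0 mcoeff1 eqxx.
by move/eqP; rewrite oner_eq0.
Qed.

End Cover.

(* [r 0] is the rank of the free module containing Z, so that [r i.+1] is the   *)
(* rank of the i-th module of the resolution.                                   *)
Section System.
Variables (r : nat -> nat) (sh : forall i, 'I_(r i) -> nat).
Variable phi : forall i, 'M[S]_(r i.+1, r i).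
Variable Z : nat -> 'rV[S]_(r 0) -> Prop.

Definition sysZ i : nat -> 'rV[S]_(r i) -> Prop :=
  match i with 0 => Z | i'.+1 => syz (@sh i'.+1) (phi i') end.

Hypothesis Z0 : forall j, Z j 0.
Hypothesis Z_in : forall i j v, free (@sh i.+1) j v -> @sysZ i j (v *m phi i).
Hypothesis Z_sur : forall i j z, @sysZ i j z -> exists2 v, free (@sh i.+1) j v & v *m phi i = z.

Lemma sysZ0 i j : @sysZ i j 0.
Proof. by case: i => [|i] //; split; [apply: homrow0 | rewrite mul0mx]. Qed.

(** H_p of the i-th syzygy module reduces to H_0 of the (i + p)-th, which is zero above the degrees
    of its generators. *)
Lemma system_vanish s : (forall i k, (@sh i.+1 k <= s + i)%N) ->
  forall p i j, (s + i + p < j)%N -> vanish (@xact K n _) (@sysZ i) l p j.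
Proof.
move=> Hs; elim=> [|p IH] i j Hj.
  apply: (cover_image0 (sh' := @sh i.+1) (phi := phi i)) => //.
  - exact: sysZ0.
  - exact: Z_in.
  - exact: Z_sur.
  by move=> k; apply: leq_ltn_trans (Hs i k) _; move: Hj; clear; lia.
apply: (cover_image (sh' := @sh i.+1) (phi := phi i)) => //.
- exact: sysZ0.
- exact: Z_in.
- exact: Z_sur.
by apply: (IH i.+1); move: Hj; clear; lia.
Qed.

Hypothesis phi_min : forall i, minimal_cover (@sh i.+1) (phi i).

(** By [cover_degree], a generator of too large degree contradicts the vanishing of H_0 of the i-th
    syzygy module, inherited from H_i of Z. *)
Lemma system_degrees s : (forall p j, (s + p < j)%N -> vanish (@xact K n _) Z l p j) ->
  forall i k, (@sh i.+1 k <= s + i)%N.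
Proof.
move=> HZ i k; rewrite leqNgt; apply/negP => Hk.
have V : forall i p j, (s + i + p < j)%N -> vanish (@xact K n _) (@sysZ i) l p j.
  elim=> [|i' IH] p j Hj; first by apply: HZ; move: Hj; clear; lia.
  apply: (cover_kernel (phi := phi i') (@sysZ0 i')) => //.
  - exact: Z_in.
  - exact: Z_sur.
  by apply: IH; move: Hj; clear; lia.
apply: (cover_degree (@sysZ0 i) _ _ (@phi_min i) (V i 0%N _ _)).
- exact: Z_in.
- exact: Z_sur.
by rewrite addn0; exact: Hk.
Qed.

End System.
End Resolution.

(** * Finite and minimal systems of homogeneous generators *)

Section Generators.
Variables (K : fieldType) (n : nat) (l : seq 'I_n).
Local Notation S := {mpoly K[n]}.
Local Notation mon := 'X_{1..n}.
Local Notation free sh := (homrow sh (fun=> True)).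
Variables (m : nat) (sh : 'I_m -> nat) (Z : nat -> 'rV[S]_m -> Prop).
Hypothesis Z_free : forall j z, Z j z -> free sh j z.
Hypothesis Z0 : forall j, Z j 0.
Hypothesis ZB : forall j x y, Z j x -> Z j y -> Z j (x - y).
Hypothesis Zscale : forall c j z, Z j z -> Z j (c%:MP *: z).

Definition spans r (sh' : 'I_r -> nat) (phi : 'M[S]_(r, m)) (j : nat) (z : 'rV[S]_m) :=
  exists2 v, free sh' j v & v *m phi = z.

Definition gens r (sh' : 'I_r -> nat) (phi : 'M[S]_(r, m)) := forall k, Z (sh' k) (row k phi).

Lemma spansB r sh' phi j x y : @spans r sh' phi j x -> spans sh' phi j y ->
  spans sh' phi j (x - y).
Proof.
move=> [v Hv <-] [w Hw <-]; exists (v - w); first exact: homrowB.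
by rewrite mulmxBl.
Qed.

Lemma spans0 r sh' phi j : @spans r sh' phi j 0.
Proof. by exists 0; [apply: homrow0 | rewrite mul0mx]. Qed.

Lemma spans_scale r sh' phi j c x : @spans r sh' phi j x -> spans sh' phi j (c%:MP *: x).
Proof.
move=> [v Hv <-]; exists (c%:MP *: v); last by rewrite scalemxAl.
by apply: free_scale Hv; apply: hpoly_const.
Qed.

Lemma spans_act r sh' phi i j x : @spans r sh' phi j x -> spans sh' phi j.+1 (xact K m i x).
Proof.
move=> [v Hv <-]; exists (xact K r i v); last by rewrite mulmx_act.
exact: homrow_act.
Qed.

Lemma gens_add r sh' phi d g : @gens r sh' phi -> Z d g ->
  exists r2 sh2 phi2, [/\ @gens r2 sh2 phi2,
    forall j z, spans sh' phi j z -> spans sh2 phi2 j z & spans sh2 phi2 d g].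
Proof.
move=> Hphi Hg.
pose sh2 (k : 'I_(1 + r)) := match split k with inl _ => d | inr k' => sh' k' end.
have shl k : sh2 (lshift r k) = d.
  by rewrite /sh2; case: split_ordP => // k' /eqP; rewrite eq_lrshift.
have shr k : sh2 (rshift 1 k) = sh' k.
  by rewrite /sh2; case: split_ordP => k' /eqP; rewrite ?eq_rlshift // eq_rshift => /eqP ->.
exists (1 + r)%N, sh2, (col_mx g phi); split.
- move=> k; case: (split_ordP k) => k' ->; rewrite ?shl ?shr.
    by rewrite rowKu; congr (Z d _): Hg; apply/rowP => i; rewrite mxE ord1.
  by rewrite rowKd; apply: Hphi.
- move=> j z [v /free_hpoly Hv <-]; exists (row_mx 0 v); last by rewrite mul_row_col mul0mx add0r.
  apply/free_hpoly => k; case: (split_ordP k) => k' ->; rewrite ?row_mxEl ?row_mxEr ?shl ?shr //.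
  by rewrite mxE; apply: hpoly0.
exists (row_mx 1%:M 0); last by rewrite mul_row_col mul1mx mul0mx addr0.
apply/free_hpoly => k; case: (split_ordP k) => k' ->; rewrite ?row_mxEl ?row_mxEr ?shl ?shr //.
  by rewrite !ord1 mxE -mpolyC1; apply: hpoly_const.
by rewrite mxE; apply: hpoly0.
Qed.

(** Gaussian elimination: the finitely many coefficients in [fs] separate W, and each costs at most
    one new generator before W shrinks to its kernel. *)
Lemma gens_subspace (fs : seq ('I_m * mon)) d (W : 'rV[S]_m -> Prop) r sh' phi :
  @gens r sh' phi -> (forall w, W w -> Z d w) ->
  (forall c w w', W w -> W w' -> W (w - c%:MP *: w')) ->
  (forall w, W w -> (forall f, f \in fs -> (w 0 f.1)@_f.2 = 0) -> w = 0) ->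
  exists r2 sh2 phi2, [/\ @gens r2 sh2 phi2,
    forall j z, spans sh' phi j z -> spans sh2 phi2 j z &
    forall w, W w -> spans sh2 phi2 d w].
Proof.
elim: fs W r sh' phi => [|f fs IH] W r sh' phi Hphi WZ WB W0.
  by exists r, sh', phi; split=> // w /W0 ->; [apply: spans0 | ].
have [[w1 [Ww1 fw1]]|Hno] := classic (exists w, W w /\ (w 0 f.1)@_f.2 <> 0).
  have [r1 [sh1 [phi1 [Hphi1 sub1 Hw1]]]] := gens_add Hphi (WZ _ Ww1).
  have [|||r2 [sh2 [phi2 [Hphi2 sub2 Hw2]]]] :=
    IH (fun w => W w /\ (w 0 f.1)@_f.2 = 0) r1 sh1 phi1 Hphi1.
  - by move=> w [/WZ].
  - move=> c w w' [Ww fw] [Ww' fw']; split; first exact: WB.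
    by rewrite !mxE mcoeffB mcoeffCM fw fw' mulr0 subr0.
  - by move=> w [Ww fw] H; apply: W0 => // f'; rewrite inE => /predU1P[->|/H].
  exists r2, sh2, phi2; split=> // [j z /sub1 /sub2 //|w Ww].
  set a := (w 0 f.1)@_f.2; set b := (w1 0 f.1)@_f.2 in fw1.
  have b0 : b != 0 by apply/eqP.
  rewrite -[w](subrK ((a / b)%:MP *: w1)) -[X in _ + X]opprK.
  apply: spansB.
    apply: Hw2; split; first exact: WB.
    by rewrite !mxE mcoeffB mcoeffCM -/a -/b divfK // subrr.
  rewrite -sub0r; apply: spansB; first exact: spans0.
  by apply: spans_scale; apply: sub2.
apply: IH => // w Ww H; apply: W0 => // f'; rewrite inE => /predU1P[->|/H //].
by apply: NNPP => Hf; apply: Hno; exists w.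
Qed.

Lemma gens_upto B : exists r sh' phi, @gens r sh' phi /\
  forall j z, (j < B)%N -> Z j z -> spans sh' phi j z.
Proof.
elim: B => [|B [r [sh' [phi [Hphi HB]]]]].
  by exists 0%N, (fun=> 0%N), 0; split=> // -[].
pose fs := [seq (k, val u) | k <- enum 'I_m, u <- enum ('X_{1..n < B.+1} : finType)].
have [||| r2 [sh2 [phi2 [Hphi2 sub2 H2]]]] := @gens_subspace fs B (Z B) _ _ _ Hphi => //.
- by move=> c w w' Hw Hw'; apply: ZB => //; apply: Zscale.
- move=> w /Z_free Hw H; apply/rowP => k; apply/mpolyP => u; rewrite mxE mcoeff0.
  have [ltu|leu] := ltnP (mdeg u) B.+1; last first.
    by apply/eqP; apply: contraTT leu => /Hw [E _]; rewrite -ltnNge ltnS -E leq_addr.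
  by apply: (H (k, u)); apply/allpairsP; exists (k, BMultinom ltu); rewrite !mem_enum.
exists r2, sh2, phi2; split=> // j z; rewrite ltnS leq_eqVlt => /predU1P[->|ltj]; first exact: H2.
by move=> /(HB _ _ ltj); apply: sub2.
Qed.

(** Takes the place of Hilbert's basis theorem: above degree B, vanishing of H_0 writes each element
    as a sum of variables times elements of Z of lower degree. *)
Lemma gens_all B : (forall j, (B < j)%N -> vanish (xact K m) Z l 0 j) ->
  exists r sh' phi, @gens r sh' phi /\ forall j z, Z j z -> spans sh' phi j z.
Proof.
move=> HZ; have [r [sh' [phi [Hphi HB]]]] := gens_upto B.+1.
exists r, sh', phi; split=> // j; have [N] := ubnP j; elim: N j => // N IH j ltj z Hz.
have [leB|ltB] := leqP j B; first exact: HB.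
have [||b Hb db] := HZ j ltB (kemb l z).
- exact: kin_emb.
- by apply: (@kd_kin0 _ _ _ Z _ j); apply: kin_emb.
have {}Hb : kin (spans sh' phi) 1 j b.
  apply: kin_sub Hb => [i|i w]; first exact: spans0.
  by rewrite addn1 => Ei; apply: IH; rewrite -ltnS Ei.
rewrite -(kbot_emb l z) -db; apply: (@kbot_in _ _ _ l); apply: kd_kin Hb => //.
- exact: spans0.
- exact: spansB.
- exact: spans_act.
Qed.

Lemma gens_minimal r sh' phi : @gens r sh' phi -> (forall j z, Z j z -> spans sh' phi j z) ->
  exists r2 sh2 phi2, [/\ @gens r2 sh2 phi2, forall j z, Z j z -> spans sh2 phi2 j z &
    minimal_cover sh2 phi2].
Proof.
elim: r sh' phi => [|r IH] sh' phi Hphi HZ.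
  by exists 0%N, sh', phi; split=> // j v _ [].
have [Hmin|Hnot] := classic (minimal_cover sh' phi); first by exists r.+1, sh', phi.
have [j0 [w [k0 [Hw w0 wk]]]] : exists j0 w k0,
    [/\ free sh' j0 w, w *m phi = 0 & (w 0 k0)@_0 != 0].
  apply: NNPP => H; apply: Hnot => j v [Hv v0] k; apply: NNPP => vk.
  by apply: H; exists j, v, k; split=> //; apply/eqP.
have [Ej0 _] := Hw _ _ wk; rewrite mdeg0 add0n in Ej0.
set c := (w 0 k0)@_0 in wk.
have Ew : w 0 k0 = c%:MP.
  apply/mpolyP => u; rewrite mcoeffC; have [->|u0] := eqVneq u 0%MM; first by rewrite mulr1.
  rewrite mulr0; apply/eqP; apply: contraNT u0 => /Hw [E _].
  by rewrite -mdeg_eq0; move: E; rewrite Ej0; clear; lia.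
apply: (IH (fun k => sh' (lift k0 k)) (row' k0 phi)).
  by move=> k; have := Hphi (lift k0 k); congr (Z _ _); apply/rowP => i; rewrite !mxE.
move=> j z /HZ [v Hv <-].
pose v' := v - (v 0 k0 * (c^-1)%:MP) *: w.
have v'k : v' 0 k0 = 0.
  by rewrite !mxE Ew -mulrA -mpolyCM mulVf // mpolyC1 mulr1 subrr.
have Hv' : free sh' j v'.
  apply: homrowB => //; apply: free_scale Hw; rewrite -Ej0.
  apply: (hpolyM (d := sh' k0)); last exact: hpoly_const.
  by move/free_hpoly: Hv; apply.
exists (col' k0 v').
  by apply/free_hpoly => k; rewrite mxE; move/free_hpoly: Hv'; apply.
have -> : v *m phi = v' *m phi by rewrite mulmxBl -scalemxAl w0 scaler0 subr0.
apply/rowP => i; rewrite !mxE [RHS](bigD1_ord k0) //= v'k mul0r add0r.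
by apply: eq_bigr => k _; rewrite !mxE.
Qed.

Lemma minimal_generators B : (forall j, (B < j)%N -> vanish (xact K m) Z l 0 j) ->
  exists r sh' phi, [/\ @gens r sh' phi, forall j z, Z j z -> spans sh' phi j z &
    minimal_cover sh' phi].
Proof. by move=> /gens_all [r [sh' [phi [Hphi HZ]]]]; apply: gens_minimal HZ. Qed.

End Generators.

Section MonomialIdeal.
Variables (K : fieldType) (n : nat).
Local Notation S := {mpoly K[n]}.
Local Notation mon := 'X_{1..n}.
Local Notation free sh := (homrow sh (fun=> True)).
Variables (U : mon -> Prop) (I : S -> Prop).
Hypothesis U_up : upclosed U.
Hypothesis I_U : forall p, I p <-> forall u, p@_u != 0 -> U u.

Local Notation ZU := (@homrow K n 1 (fun=> 0%N) U).

Lemma monideal0 : I 0.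
Proof. by apply/I_U => u; rewrite mcoeff0 eqxx. Qed.

Lemma monidealD p q : I p -> I q -> I (p + q).
Proof.
move=> /I_U Hp /I_U Hq; apply/I_U => u; rewrite mcoeffD.
by have [->|/Hp //] := eqVneq p@_u 0; rewrite add0r; apply: Hq.
Qed.

Lemma monidealM p q : I q -> I (p * q).
Proof.
move=> /I_U Hq; apply/I_U => u.
rewrite -mcoeff_msupp => /msuppM_le /allpairsP[[u1 u2] /= [_]].
by rewrite mcoeff_msupp => /Hq Hu ->; rewrite addmC; apply: U_up.
Qed.

Lemma homrow_ideal j v : ZU j v -> I (v 0 0).
Proof. by move=> Hv; apply/I_U => u /Hv []. Qed.

Lemma ideal_homrow j v : free (fun=> 0%N) j v -> I (v 0 0) -> ZU j v.
Proof. by move=> Hv /I_U Hu k u; rewrite ord1 => H; split; [apply: (Hv 0 u H).1 | apply: Hu]. Qed.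

Section Lifting.
Variables (r m : nat) (sh' : 'I_r -> nat) (sh : 'I_m -> nat) (phi : 'M[S]_(r, m)).
Variable Z : nat -> 'rV[S]_m -> Prop.
Hypothesis Z_sur : forall j z, Z j z -> exists2 v, free sh' j v & v *m phi = z.

Lemma lift_components z : (forall j, Z j (hcomp sh j z)) -> exists v, z = v *m phi.
Proof.
move=> Hz; have [N /(_ N (leqnn N)) ->] := hcomp_sum sh z.
elim: N => [|N [v Hv]]; first by exists 0; rewrite big_ord0 mul0mx.
have [w _ Hw] := Z_sur (Hz N); exists (v + w).
by rewrite big_ord_recr /= Hv -Hw mulmxDl.
Qed.
End Lifting.

(* The ring is put in degree -1, so that [aug F] becomes the zeroth differential. *)
Section FromResolution.
Variable F : graded_free_resolution I.

Definition xrk i := if i is i'.+1 then rk F i' else 1%N.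
Definition xshift i : 'I_(xrk i) -> nat :=
  match i with 0 => fun=> 0%N | i'.+1 => @shift _ _ _ F i' end.
Definition xdiff i : 'M[S]_(xrk i.+1, xrk i) :=
  match i with 0 => aug F | i'.+1 => diff F i' end.

Lemma xdiff_homog i k : free (@xshift i) (@xshift i.+1 k) (row k (xdiff i)).
Proof.
case: i k => [|i] k c u; rewrite mxE /=.
  move=> H; split=> //; rewrite addn0; have /dhomogP := @aug_homog _ _ _ F k; apply.
  by rewrite mcoeff_msupp; move: H; rewrite ord1.
case: (@diff_homog _ _ _ F _ k c) => [->|[e -> He] H]; first by rewrite mcoeff0 eqxx.
by split=> //; rewrite addnC; congr addn; move/dhomogP: He; apply; rewrite mcoeff_msupp.
Qed.

Lemma xZ_in i j v : free (@xshift i.+1) j v -> @sysZ K n xrk (@xshift) xdiff ZU i j (v *m xdiff i).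
Proof.
move=> Hv; have Hf := free_mul (@xdiff_homog i) Hv; case: i v Hv Hf => [|i] v Hv Hf.
  by apply: ideal_homrow => //; apply/(@aug_image _ _ _ F); exists v.
split=> //; case: i v Hv Hf => [|i] v Hv Hf /=.
  by apply/(@exact_aug _ _ _ F); exists v.
by apply/(@exact_diff _ _ _ F); exists v.
Qed.

Lemma xZ_sur i j z : @sysZ K n xrk (@xshift) xdiff ZU i j z ->
  exists2 v, free (@xshift i.+1) j v & v *m xdiff i = z.
Proof.
move=> Hz; have [Hf [v Ev]] : free (@xshift i) j z /\ exists v, z = v *m xdiff i.
  case: i z Hz => [|i] z.
    move=> Hz; split; first by apply: homrow_sub Hz.
    have /(@aug_image _ _ _ F) [v Ev] := homrow_ideal Hz; exists v.
    by apply/rowP => k; rewrite ord1.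
  move=> [Hz z0]; split=> //; case: i z Hz z0 => [|i] z Hz z0.
    exact/(@exact_aug _ _ _ F).
  exact/(@exact_diff _ _ _ F).
exists (hcomp (@xshift i.+1) j v); first exact: hcomp_free.
by rewrite -(hcomp_mul _ _ (@xdiff_homog i)) -Ev hcomp_id.
Qed.

Lemma resolution_mreg l s : uniq l -> l =i 'I_n ->
  (forall i (k : 'I_(rk F i)), (shift k <= s + i)%N) -> @mreg K n l U s.
Proof.
move=> ul fl Hs p j Hj.
apply: (system_vanish ul fl (Z := ZU) _ xZ_in xZ_sur (s := s) _ (i := 0)) => //.
- by move=> i; apply: homrow0.
- by rewrite addn0.
Qed.

Lemma minimal_resolution_degrees l s : uniq l -> l =i 'I_n -> minimal_resolution F ->
  @mreg K n l U s -> forall i (k : 'I_(rk F i)), (shift k <= s + i)%N.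
Proof.
move=> ul fl Fmin HU.
apply: (system_degrees ul fl (Z := ZU) _ xZ_in xZ_sur _ (s := s)) => //.
  by move=> i; apply: homrow0.
(* A syzygy combines rows of the next differential, whose entries have no constant term. *)
move=> i j v Hv k; have [w Hw <-] := @xZ_sur i.+1 j v Hv.
rewrite mxE raddf_sum big1 // => t _ /=.
by rewrite -[LHS]/((mcoeff 0%MM \o _) _) /= rmorphM /= Fmin mulr0.
Qed.

End FromResolution.
End MonomialIdeal.

(** * Existence of minimal resolutions and of the regularity *)

Section Existence.
Variables (K : fieldType) (n : nat) (l : seq 'I_n).
Hypotheses (l_uniq : uniq l) (l_full : l =i 'I_n).
Local Notation S := {mpoly K[n]}.
Local Notation mon := 'X_{1..n}.
Local Notation free sh := (homrow sh (fun=> True)).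

(** A homogeneous submodule of a graded free module with what is needed to cover it and repeat with
    the syzygies; [st_vanish] guarantees finite generation. *)
Record stage := Stage {
  st_rk : nat;
  st_shift : 'I_st_rk -> nat;
  st_mod : nat -> 'rV[S]_st_rk -> Prop;
  st_free : forall j z, st_mod j z -> free st_shift j z;
  st_0 : forall j, st_mod j 0;
  st_B : forall j x y, st_mod j x -> st_mod j y -> st_mod j (x - y);
  st_act : forall i j z, st_mod j z -> st_mod j.+1 (xact K st_rk i z);
  st_scale : forall c j z, st_mod j z -> st_mod j (c%:MP *: z);
  st_vanish : exists B, forall p j : nat, (B + p < j)%N ->
    vanish (xact K st_rk) st_mod l p j
}.

Arguments st_mod : clear implicits.

Definition next_stage_spec (s : stage) (t : {t : stage & 'M[S]_(st_rk t, st_rk s)}) :=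
  let: existT t phi := t in
  [/\ gens (st_mod s) (@st_shift t) phi,
      forall j z, st_mod s j z -> spans (@st_shift t) phi j z,
      minimal_cover (@st_shift t) phi &
      @st_mod t = syz (@st_shift t) phi].

Lemma gens_homog (s : stage) r (sh' : 'I_r -> nat) phi :
  gens (st_mod s) sh' phi -> forall k, free (@st_shift s) (sh' k) (row k phi).
Proof. by move=> Hphi k; apply: st_free (Hphi k). Qed.

Lemma gens_in (s : stage) r (sh' : 'I_r -> nat) phi : gens (st_mod s) sh' phi ->
  forall j v, free sh' j v -> st_mod s j (v *m phi).
Proof.
move=> Hphi j v Hv.
have ZD i x y : st_mod s i x -> st_mod s i y -> st_mod s i (x + y).
  move=> Hx Hy; rewrite -[y]opprK; apply: st_B => //; rewrite -sub0r; apply: st_B => //.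
  exact: st_0.
have Zmon d (u : mon) i z : mdeg u = d -> st_mod s i z -> st_mod s (d + i)%N ('X_[u] *: z).
  elim: d u => [|d IH] u du Hz.
    by move/eqP: du; rewrite mdeg_eq0 => /eqP ->; rewrite mpolyX0 scale1r.
  have [k uk] : exists k, u k != 0%N.
    apply/existsP; apply: contra_eqT du; rewrite negb_exists => /forallP H.
    by rewrite mdegE big1 // => k _; apply/eqP; have := H k; rewrite negbK.
  have Eu : (U_(k) + (u - U_(k)))%MM = u by rewrite addmC submK // lep1mP.
  have Ed : mdeg (u - U_(k))%MM = d.
    by move: du; rewrite -{1}Eu mdegD mdeg1; clear; lia.
  rewrite -Eu mpolyXD -scalerA.
  by apply: (st_act (s := s)); apply: IH.
rewrite mulmx_sum_row; elim: (index_enum _) => [|k r' IH].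
  by rewrite big_nil; apply: st_0.
rewrite big_cons; apply: (ZD) => //.
have Hk := Hphi k; have := mpolyE (v 0 k).
move=> ->; rewrite scaler_suml big_seq; apply: big_ind => [||u uv]; [exact: st_0 | exact: ZD |].
rewrite -mul_mpolyC -scalerA; apply: st_scale.
have /Hv [Ej _] : (v 0 k)@_u != 0 by rewrite -mcoeff_msupp.
by rewrite -Ej; apply: Zmon => //; apply: Hphi.
Qed.

Lemma next_stage_exists (s : stage) : exists t, @next_stage_spec s t.
Proof.
have [B HB] := st_vanish s.
have [r [sh' [phi [Hphi Hs Hmin]]]] : exists r sh' phi, [/\ @gens _ _ _ (st_mod s) r sh' phi,
    forall j z, st_mod s j z -> spans sh' phi j z & minimal_cover sh' phi].
  apply: (minimal_generators (l := l) (sh := @st_shift s) _ _ _ _ _ (B := B)).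
  - exact: st_free.
  - exact: st_0.
  - exact: st_B.
  - exact: st_scale.
  - by move=> j Hj; apply: HB; rewrite addn0.
have V : exists B', forall p j : nat, (B' + p < j)%N -> vanish (xact K r) (syz sh' phi) l p j.
  (* H_p of the syzygies is governed by H_(p+1) of the module covered, so the bound grows by one. *)
  exists B.+1 => p j Hj; apply: (cover_kernel l_uniq l_full (Z := st_mod s)) => //.
  - exact: st_0.
  - exact: gens_in.
  by apply: HB; move: Hj; clear; lia.
unshelve eexists (existT _ (@Stage r sh' (syz sh' phi) _ _ _ _ _ V) phi); last by split.
- by move=> j z [].
- by move=> j; split; [apply: homrow0 | rewrite mul0mx].
- by move=> j x y [Hx Ex] [Hy Ey]; split; [apply: homrowB | rewrite mulmxBl Ex Ey subrr].
- by move=> i j z [Hz Ez]; split; [apply: homrow_act | rewrite mulmx_act Ez raddf0].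
- move=> c j z [Hz Ez]; split; last by rewrite -scalemxAl Ez scaler0.
  by apply: free_scale Hz; apply: hpoly_const.
Qed.

Definition next_stage (s : stage) : {t : stage & 'M[S]_(st_rk t, st_rk s)} :=
  sval (constructive_indefinite_description _ (next_stage_exists s)).

Lemma next_stageP s : @next_stage_spec s (next_stage s).
Proof. exact: svalP. Qed.

Variables (U : mon -> Prop) (I : S -> Prop) (s0 : nat).
Hypothesis U_up : upclosed U.
Hypothesis I_U : forall p, I p <-> forall u, p@_u != 0 -> U u.
Hypothesis U_reg : @mreg K n l U s0.

Local Notation ZU := (@homrow K n 1 (fun=> 0%N) U).

Definition stage0 : stage.
Proof.
refine (@Stage 1 (fun=> 0%N) ZU _ _ _ _ _ (ex_intro _ s0 U_reg)).
- by move=> j z; apply: homrow_sub.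
- by move=> j; apply: homrow0.
- by move=> j x y; apply: homrowB.
- by move=> i j z; apply: homrow_act => u Hu; apply: U_up.
- move=> c j z Hz k u; rewrite mxE mcoeffCM mulf_eq0 negb_or => /andP[_]; exact: Hz.
Defined.

Fixpoint stages i : stage := if i is i'.+1 then projT1 (next_stage (stages i')) else stage0.

Definition res_rk i := st_rk (stages i).
Definition res_shift i : 'I_(res_rk i) -> nat := @st_shift (stages i).
Definition res_diff i : 'M[S]_(res_rk i.+1, res_rk i) := projT2 (next_stage (stages i)).

Lemma stagesP i : [/\ gens (st_mod (stages i)) (@res_shift i.+1) (res_diff i),
      forall j z, st_mod (stages i) j z -> spans (@res_shift i.+1) (res_diff i) j z,
      minimal_cover (@res_shift i.+1) (res_diff i) &
      @st_mod (stages i.+1) = syz (@res_shift i.+1) (res_diff i)].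
Proof.
have := next_stageP (stages i).
by rewrite /next_stage_spec /res_shift /res_diff /res_rk /=; case: (next_stage _).
Qed.

Lemma res_homog i k : free (@res_shift i) (@res_shift i.+1 k) (row k (res_diff i)).
Proof. by have [H _ _ _] := stagesP i; apply: gens_homog. Qed.

Lemma res_exact i (v : 'rV[S]_(res_rk i.+1)) :
  v *m res_diff i = 0 <-> exists w, v = w *m res_diff i.+1.
Proof.
have [_ _ _ E] := stagesP i; have [G Sp _ _] := stagesP i.+1; split=> [Hv|[w ->]].
  apply: (lift_components (sh := @res_shift i.+1) Sp) => j; rewrite E.
  by split; [apply: hcomp_free | rewrite -(hcomp_mul _ _ (@res_homog i)) Hv hcomp0].
rewrite -mulmxA (_ : _ *m res_diff i = 0) ?mulmx0 //; apply/row_matrixP => k.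
by have := G k; rewrite E row_mul => -[_ ->]; rewrite row0.
Qed.

Lemma minimal_resolution_exists : exists F : graded_free_resolution I, minimal_resolution F.
Proof.
unshelve eexists (@GradedFreeResolution K n I (fun i => res_rk i.+1) (fun i => @res_shift i.+1)
  (res_diff 0) (fun i => res_diff i.+1) _ _ _ _ _).
- move=> k; apply/dhomogP => u; rewrite mcoeff_msupp => Hu.
  by have [] := @res_homog 0 k (0 : 'I_1) u; rewrite ?mxE // addn0.
- move=> i k c /=; have [->|H] := eqVneq (res_diff i.+1 k c) 0; [by left | right].
  have Hh u : (res_diff i.+1 k c)@_u != 0 -> (mdeg u + res_shift c)%N = res_shift k.
    by move=> Hu; have [] := @res_homog i.+1 k c u; rewrite ?mxE.
  exists (mdeg (mlead (res_diff i.+1 k c))).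
    by rewrite addnC Hh // -mcoeff_msupp mlead_supp.
  apply/dhomogP => u; rewrite mcoeff_msupp => /Hh Eu.
  have := Hh (mlead (res_diff i.+1 k c)); rewrite -mcoeff_msupp mlead_supp // => /(_ isT).
  by rewrite -Eu => /eqP; rewrite eqn_add2r => /eqP.
- have [G Sp _ _] := stagesP 0 => p; split=> [Hp|[v ->]].
    have [|v Hv] := @lift_components _ _ _ _ _ (@res_shift 0) (res_diff 0) _ Sp (const_mx p).
      move=> j k u; rewrite mcoeff_hcomp mxE addn0.
      case: (eqVneq (mdeg u) j) => [<-|_]; last by rewrite eqxx.
      by move/I_U: Hp => Hp /Hp.
    by exists v; rewrite -Hv mxE.
  rewrite mxE; apply: big_ind => [||k _]; [exact: monideal0 I_U | exact: monidealD I_U |].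
  apply: (monidealM U_up I_U); apply/I_U => u Hu.
  by have [] := G k (0 : 'I_1) u; rewrite ?mxE.
- exact: (res_exact (i := 0)).
- by move=> i; apply: res_exact.
move=> i k c /=; have [_ _ Hmin E] := stagesP i; have [G _ _ _] := stagesP i.+1.
by have := G k; rewrite E => /Hmin /(_ c); rewrite mxE.
Qed.

Hypothesis U_nonempty : exists u, U u.

(** Take the least r bounding all differences of shift and homological degree. Leastness yields
    equality somewhere if r > 0; for r = 0 any generator of F_0 attains it, and one exists as the
    ideal is nonzero. *)
Lemma regularity_exists : exists r, is_regularity I r.
Proof.
have [F Fmin] := minimal_resolution_exists.
have Hs := minimal_resolution_degrees I_U l_uniq l_full Fmin U_reg.
have rk0 : exists k : 'I_(rk F 0), True.
  apply: NNPP => Hno; have [u Hu] := U_nonempty.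
  have IX : I 'X_[u].
    by apply/I_U => w; rewrite mcoeffX; case: (eqVneq u w) => [<- //|_]; rewrite eqxx.
  have [v] := (@aug_image _ _ _ F _).1 IX; rewrite mxE big1.
    by move/mpolyP/(_ u); rewrite mcoeffX eqxx mcoeff0 => /eqP; rewrite oner_eq0.
  by move=> k _; case: Hno; exists k.
pose P r := forall i (k : 'I_(rk F i)), (shift k <= r + i)%N.
have [r [Pr Hr]] : exists r, P r /\ forall r', (r' < r)%N -> ~ P r'.
  have : P s0 by exact: Hs.
  have [N] := ubnP s0; elim: N s0 => // N IH s ltN Ps.
  have [[r' [lt' Pr']]|Hno] := classic (exists r', (r' < s)%N /\ P r').
    by apply: (IH r') => //; move: ltN lt'; clear; lia.
  by exists s; split=> // r' lt' Pr'; apply: Hno; exists r'.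
exists r, F; split=> //; case: r Pr Hr => [|r] Pr Hr.
  have [k _] := rk0; exists 0%N, k; apply/eqP.
  by rewrite eqn_leq Pr.
apply: NNPP => Hno; apply: (Hr r) => // i k.
have := Pr i k; rewrite addSn leq_eqVlt ltnS => /orP[/eqP E|//].
by case: Hno; exists i, k.
Qed.

Lemma reg_is_regularity : is_regularity I (reg I).
Proof.
have Hex := epsilon_spec (inhabits 0%N) (is_regularity I) regularity_exists.
rewrite /reg; case: excluded_middle_informative => [H|nH]; last exact: Hex.
have [u Hu] := U_nonempty; have : 'X_[u] = 0 :> S.
  by apply: H; apply/I_U => w; rewrite mcoeffX; case: (eqVneq u w) => [<- //|_]; rewrite eqxx.
by move/mpolyP/(_ u); rewrite mcoeffX eqxx mcoeff0 => /eqP; rewrite oner_eq0.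
Qed.

Lemma reg_le_mreg s : @mreg K n l U s -> (reg I <= s)%N.
Proof.
move=> HU; have [F [Fmin _ [i [k Ek]]]] := reg_is_regularity.
by have := minimal_resolution_degrees I_U l_uniq l_full Fmin HU k; rewrite Ek leq_add2r.
Qed.

(** The freedom to list the variables in another order is what [reg_embed] uses. *)
Lemma mreg_reg (l' : seq 'I_n) : uniq l' -> l' =i 'I_n -> @mreg K n l' U (reg I).
Proof.
move=> ul' fl'; have [F [_ HF _]] := reg_is_regularity.
by apply: (resolution_mreg (F := F) I_U).
Qed.

End Existence.

(** * Induced subgraphs *)

Section Renaming.
Variables (T1 T2 : eqType) (f : T1 -> T2) (M N : zmodType).

Fixpoint kren (h : M -> N) (l : seq T1) : kos M l -> kos N (map f l) :=
  if l is _ :: l' then fun c => (kren h c.1, kren h c.2) else h.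

Fixpoint kunren (h : N -> M) (l : seq T1) : kos N (map f l) -> kos M l :=
  if l is _ :: l' then fun c => (kunren h c.1, kunren h c.2) else h.

Fixpoint kext (r l : seq T2) (c : kos N l) : kos N (r ++ l) :=
  if r is _ :: r' then (kext r' c, 0) else c.

Fixpoint kproj (r l : seq T2) : kos N (r ++ l) -> kos N l :=
  if r is _ :: r' then fun c => @kproj r' l c.1 else id.

Lemma kunren_proj_ren (h : M -> N) (h' : N -> M) r l c : cancel h h' ->
  kunren h' (kproj (kext r (@kren h l c))) = c.
Proof.
move=> hK; have -> : kproj (kext r (kren h c)) = kren h c by elim: r.
elim: l c => [|z l IH] /= c; first exact: hK.
by case: c => a b; rewrite /= !IH.
Qed.

Variables (actM : T1 -> {additive M -> M}) (actN : T2 -> {additive N -> N}).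
Variables (h : {additive M -> N}) (h' : {additive N -> M}).
Hypothesis h_act : forall z m, h (actM z m) = actN (f z) (h m).
Hypothesis h'_act : forall z m, h' (actN (f z) m) = actM z (h' m).

Lemma krenB l : {morph @kren h l : x y / x - y}.
Proof.
elim: l => [|z l IH] /=; first exact: raddfB.
by move=> [a b] [a' b']; apply: (f_equal2 pair) => /=; rewrite IH.
Qed.

Lemma kunrenB l : {morph @kunren h' l : x y / x - y}.
Proof.
elim: l => [|z l IH] /=; first exact: raddfB.
by move=> [a b] [a' b']; apply: (f_equal2 pair) => /=; rewrite IH.
Qed.

HB.instance Definition _ l := GRing.isZmodMorphism.Build _ _ (@kren h l) (@krenB l).
HB.instance Definition _ l := GRing.isZmodMorphism.Build _ _ (@kunren h' l) (@kunrenB l).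

Lemma kd_kren l c : kd actN (@kren h l c) = kren h (kd actM c).
Proof.
have act z l' (b : kos M l') : kmap (actN (f z)) (kren h b) = kren h (kmap (actM z) b).
  by elim: l' b => [|y l' IH] /= b; rewrite ?h_act // !IH.
elim: l c => [|z l IH] /= c; first by rewrite raddf0.
by rewrite !IH act raddfD raddfN.
Qed.

Lemma kd_kunren l c : kd actM (@kunren h' l c) = kunren h' (kd actN c).
Proof.
have act z l' (b : kos N (map f l')) :
    kmap (actM z) (kunren h' b) = kunren h' (kmap (actN (f z)) b).
  by elim: l' b => [|y l' IH] /= b; rewrite ?h'_act // !IH.
elim: l c => [|z l IH] /= c; first by rewrite raddf0.
by rewrite !IH act raddfD raddfN.
Qed.

Lemma kd_kext r l c : kd actN (@kext r l c) = kext r (kd actN c).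
Proof. by elim: r => //= z r IH; rewrite IH !raddf0 addr0. Qed.

Lemma kproj_kd r l (c : kos N (r ++ map f l)) :
  (forall z m, z \in r -> h' (actN z m) = 0) ->
  kunren h' (kproj (kd actN c)) = kunren h' (kd actN (kproj c)).
Proof.
elim: r c => //= z r IH [a b] /= Hr.
have Hr' y m : y \in r -> h' (actN y m) = 0 by move=> yr; apply: Hr; rewrite inE yr orbT.
have projD : forall r' (x y : kos N (r' ++ map f l)), kproj (x + y) = kproj x + kproj y.
  by elim=> //= z' r' IHr x y; rewrite -IHr.
rewrite projD raddfD /= IH //.
rewrite [X in _ + X](_ : _ = 0) ?addr0 //.
have -> : kproj (kmap (actN z) b) = kmap (actN z) (kproj b).
  by elim: (r) b {a IH Hr Hr'} => //= y r' IHr b; rewrite IHr.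
have hz m : h' (actN z m) = 0 by apply: Hr; rewrite mem_head.
by elim: (l) (kproj b) => [|y l' IHl] /= x; rewrite ?hz // !IHl.
Qed.

Lemma kin_kren (D : nat -> M -> Prop) (E : nat -> N -> Prop) l p j c :
  (forall j m, D j m -> E j (h m)) -> @kin _ M D l p j c -> kin E p j (kren h c).
Proof.
move=> DE; elim: l p j c => [|z l IH] p j c /=.
  by case: p => [|p]; [apply: DE | move=> ->; rewrite raddf0].
move=> [Ha Hb]; split; first exact: IH.
by case: p j Ha Hb => [|p] [|j] Ha Hb; try (by rewrite Hb raddf0); apply: IH.
Qed.

Lemma kin_kunren (D : nat -> M -> Prop) (E : nat -> N -> Prop) l p j c :
  (forall j m, E j m -> D j (h' m)) -> @kin _ N E (map f l) p j c -> kin D p j (kunren h' c).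
Proof.
move=> ED; elim: l p j c => [|z l IH] p j c /=.
  by case: p => [|p]; [apply: ED | move=> ->; rewrite raddf0].
move=> [Ha Hb]; split; first exact: IH.
by case: p j Ha Hb => [|p] [|j] Ha Hb; try (by rewrite Hb raddf0); apply: IH.
Qed.

Lemma kin_kext (E : nat -> N -> Prop) r l p j c : (forall j, E j 0) ->
  @kin _ N E l p j c -> kin E p j (kext r c).
Proof.
move=> E0 Hc; elim: r => //= z r IH; split=> //.
by case: p j {Hc IH} => [|p] [|j] //; apply: kin0.
Qed.

Lemma kin_kproj (E : nat -> N -> Prop) r l p j c :
  @kin _ N E (r ++ l) p j c -> kin E p j (kproj c).
Proof. by elim: r c => //= z r IH c [Ha _]; apply: IH. Qed.

(** The small Koszul complex is a retract of the large one: chains are extended by zero along r, and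
    the way back sets the variables of r to zero. *)
Lemma vanish_rename (D : nat -> M -> Prop) (E : nat -> N -> Prop) r l p j :
  cancel h h' -> (forall z m, z \in r -> h' (actN z m) = 0) -> (forall j, E j 0) ->
  (forall j m, D j m -> E j (h m)) -> (forall j m, E j m -> D j (h' m)) ->
  vanish actN E (r ++ map f l) p j -> vanish actM D l p j.
Proof.
move=> hK Hr E0 DE ED VE c Hc dc.
have [||b Hb db] := VE (kext r (kren h c)).
- by apply: kin_kext => //; apply: kin_kren Hc.
- by rewrite kd_kext kd_kren dc raddf0 -[RHS](_ : kext r 0 = 0) //; elim: (r) => //= z r' ->.
exists (kunren h' (kproj b)); first by apply: kin_kunren ED _; apply: kin_kproj.
by rewrite kd_kunren -kproj_kd // db kunren_proj_ren.
Qed.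

End Renaming.

Section VariableRenaming.
Variables (K : fieldType) (n1 n2 : nat) (f : 'I_n1 -> 'I_n2).
Hypothesis f_inj : injective f.
Implicit Types (u : 'X_{1..n1}) (w : 'X_{1..n2}).

Definition mpush u : 'X_{1..n2} := [multinom \sum_(i | f i == j) u i | j < n2].
Definition mpull w : 'X_{1..n1} := [multinom w (f i) | i < n1].

Lemma mpush_f u i : mpush u (f i) = u i.
Proof. by rewrite mnmE (big_pred1 i) // => j; rewrite /= (inj_eq f_inj). Qed.

Lemma mpush_notin u j : j \notin codom f -> mpush u j = 0%N.
Proof.
move=> jf; rewrite mnmE big1 // => i /eqP E; case/negP: jf; rewrite -E; exact: codom_f.
Qed.

Lemma mpushK : cancel mpush mpull.
Proof. by move=> u; apply/mnmP => i; rewrite mnmE mpush_f. Qed.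

Lemma mpushD u v : mpush (u + v)%MM = (mpush u + mpush v)%MM.
Proof.
apply/mnmP => j; rewrite mnmDE !mnmE -big_split /=; apply: eq_bigr => i _; exact: mnmDE.
Qed.

Lemma mpushU i : mpush U_(i)%MM = U_(f i)%MM.
Proof.
apply/mnmP => j; rewrite mnm1E; have [/codomP[k ->]|jf] := boolP (j \in codom f).
  by rewrite mpush_f mnm1E (inj_eq f_inj).
by rewrite mpush_notin //; case: eqP jf => // <-; rewrite codom_f.
Qed.

Lemma mdeg_mpush u : mdeg (mpush u) = mdeg u.
Proof.
rewrite !mdegE (eq_bigr (fun j => \sum_(i | f i == j) u i)%N) => [|j _]; last by rewrite mnmE.
rewrite (exchange_big_dep xpredT) //=; apply: eq_bigr => i _.
by rewrite (big_pred1 (f i)) // => j; rewrite /= eq_sym.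
Qed.

Definition ppush (p : {mpoly K[n1]}) : {mpoly K[n2]} :=
  \sum_(u <- msupp p) p@_u *: 'X_[mpush u].
Definition ppull (p : {mpoly K[n2]}) : {mpoly K[n1]} :=
  \sum_(w <- msupp p | mpush (mpull w) == w) p@_w *: 'X_[mpull w].

Lemma mcoeff_ppush p w :
  (ppush p)@_w = if mpush (mpull w) == w then p@_(mpull w) else 0.
Proof.
rewrite raddf_sum /=; case: eqP => [E|E].
  have := sum_coeff xpredT p (mpull w); rewrite /= => <-.
  apply: eq_bigr => u _; rewrite mcoeffZ mcoeffX; congr (_ * (_ : bool)%:R).
  by apply/eqP/eqP => [<-|->] //; rewrite mpushK.
apply: big1 => u _; rewrite mcoeffZ mcoeffX; case: eqP; rewrite ?mulr0 // => Eu.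
by case: E; rewrite -Eu mpushK.
Qed.

Lemma mcoeff_ppull p u : (ppull p)@_u = p@_(mpush u).
Proof.
rewrite raddf_sum /=.
have := sum_coeff (fun w => mpush (mpull w) == w) p (mpush u).
rewrite mpushK eqxx => <-; apply: eq_bigr => w /eqP Ew.
rewrite mcoeffZ mcoeffX; congr (_ * (_ : bool)%:R).
by apply/eqP/eqP => [<-|->] //; rewrite mpushK.
Qed.

Lemma ppushB : {morph ppush : p q / p - q}.
Proof.
move=> p q; apply/mpolyP => w; rewrite mcoeffB !mcoeff_ppush mcoeffB.
by case: ifP; rewrite ?subrr.
Qed.
HB.instance Definition _ := GRing.isZmodMorphism.Build _ _ ppush ppushB.

Lemma ppullB : {morph ppull : p q / p - q}.
Proof. by move=> p q; apply/mpolyP => w; rewrite mcoeffB !mcoeff_ppull mcoeffB. Qed.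
HB.instance Definition _ := GRing.isZmodMorphism.Build _ _ ppull ppullB.

Lemma ppushK : cancel ppush ppull.
Proof. by move=> p; apply/mpolyP => u; rewrite mcoeff_ppull mcoeff_ppush mpushK eqxx. Qed.

Lemma ppull_X i p : ppull ('X_(f i) * p) = 'X_i * ppull p.
Proof.
apply/mpolyP => u; rewrite mcoeff_ppull !mcoeff_XM mcoeff_ppull mpush_f.
case: ifPn => // ui; congr (_@_ _); apply: (@addIm _ U_(f i)%MM).
by rewrite submK ?lep1mP ?mpush_f // -mpushU -mpushD submK // lep1mP.
Qed.

Lemma ppull_X0 z p : z \notin codom f -> ppull ('X_z * p) = 0.
Proof.
by move=> zf; apply/mpolyP => u; rewrite mcoeff_ppull mcoeff_XM mpush_notin // mcoeff0.
Qed.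

Lemma ppush_X i p : ppush ('X_i * p) = 'X_(f i) * ppush p.
Proof.
apply/mpolyP => w; rewrite mcoeff_ppush !mcoeff_XM mcoeff_ppush mnmE.
case: (eqVneq (w (f i)) 0%N) => [_|wi]; first by rewrite if_same.
have E : mpull (w - U_(f i))%MM = (mpull w - U_(i))%MM.
  by apply/mnmP => k; rewrite !(mnmE, mnmBE, mnm1E) (inj_eq f_inj).
have Ew : (mpull w - U_(i) + U_(i) = mpull w)%MM by rewrite submK // lep1mP mnmE.
rewrite E (_ : (mpush _ == w) = (mpush (mpull w - U_(i)) == w - U_(f i)))%MM //.
rewrite -{1}Ew mpushD mpushU -{2}(submK (m := U_(f i)) (m' := w)) ?lep1mP //.
exact: eqm_add2r.
Qed.

Lemma mreg_rename (l1 : seq 'I_n1) (U1 : 'X_{1..n1} -> Prop) (U2 : 'X_{1..n2} -> Prop) s r :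
  (forall z, z \in r -> z \notin codom f) ->
  (forall u, U1 u <-> U2 (mpush u)) ->
  @mreg K n2 (r ++ map f l1) U2 s -> @mreg K n1 l1 U1 s.
Proof.
move=> Hr HU HR p j Hj.
pose h : {additive 'rV[{mpoly K[n1]}]_1 -> 'rV[{mpoly K[n2]}]_1} := map_mx ppush.
pose h' : {additive 'rV[{mpoly K[n2]}]_1 -> 'rV[{mpoly K[n1]}]_1} := map_mx ppull.
have hE v k : h v 0 k = ppush (v 0 k) by rewrite mxE.
have h'E v k : h' v 0 k = ppull (v 0 k) by rewrite mxE.
apply: (vanish_rename (actM := @xact K n1 1) (h := h) (h' := h') _ _ _ _ _ _ _ (HR p j Hj)).
- by move=> z v; apply/rowP => k; rewrite hE !xactE hE ppush_X.
- by move=> z v; apply/rowP => k; rewrite h'E !xactE h'E ppull_X.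
- by move=> v; apply/rowP => k; rewrite h'E hE ppushK.
- by move=> z v /Hr zf; apply/rowP => k; rewrite h'E xactE ppull_X0 // mxE.
- by move=> i; apply: homrow0.
- move=> i v Hv k w; rewrite hE mcoeff_ppush.
  case: (eqVneq (mpush (mpull w)) w) => [E|_]; last by rewrite eqxx.
  by move=> /Hv [Ei /HU]; rewrite E => Uw; split=> //; rewrite -E mdeg_mpush.
move=> i v Hv k u; rewrite h'E mcoeff_ppull => /Hv [Ei /HU Uu].
by split=> //; rewrite -(mdeg_mpush u).
Qed.

End VariableRenaming.

(** * Edge ideals as monomial ideals *)

Section GeneratedIdeals.
Variable R : comNzRingType.

Lemma ideal_gen0 (X : R -> Prop) : ideal_gen X 0.
Proof. by exists 0%N, (fun=> 0), (fun=> 0); rewrite big_ord0; split=> // -[]. Qed.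

Lemma ideal_genD (X : R -> Prop) p q : ideal_gen X p -> ideal_gen X q -> ideal_gen X (p + q).
Proof.
move=> [m1 [c1 [g1 [H1 ->]]]] [m2 [c2 [g2 [H2 ->]]]].
exists (m1 + m2)%N, (fun i => match split i with inl j => c1 j | inr j => c2 j end),
  (fun i => match split i with inl j => g1 j | inr j => g2 j end); split.
  by move=> i; case: split.
rewrite big_split_ord /=; congr (_ + _); apply: eq_bigr => i _.
  by have := unsplitK (inl i : 'I_m1 + 'I_m2) => /= ->.
by have := unsplitK (inr i : 'I_m1 + 'I_m2) => /= ->.
Qed.

Lemma ideal_gen_multiple (X : R -> Prop) c g : X g -> ideal_gen X (c * g).
Proof. by move=> Xg; exists 1%N, (fun=> c), (fun=> g); rewrite big_ord1. Qed.

End GeneratedIdeals.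

Section MonomialGenerators.
Variables (K : fieldType) (n : nat) (U : 'X_{1..n} -> Prop) (X : {mpoly K[n]} -> Prop).
Hypothesis U_up : upclosed U.

Lemma ideal_gen_monomial :
  (forall g, X g -> forall u, g@_u != 0 -> U u) ->
  (forall u, U u -> exists c g, X g /\ 'X_[u] = c * g) ->
  forall p, ideal_gen X p <-> forall u, p@_u != 0 -> U u.
Proof.
move=> XU UX p; split=> [[m [c [g [Hg ->]]]] | Hp].
  elim/big_ind: _ => [u|x y Hx Hy|i _]; first by rewrite mcoeff0 eqxx.
    by move=> u; rewrite mcoeffD; have [->|/Hx //] := eqVneq x@_u 0; rewrite add0r; apply: Hy.
  move=> u; rewrite -mcoeff_msupp => /msuppM_le /allpairsP[[u1 u2] /= [_]].
  by rewrite mcoeff_msupp => /(XU _ (Hg i)) Hu ->; rewrite addmC; apply: U_up.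
rewrite (mpolyE p) big_seq; elim/big_ind: _ => [|x y|u]; [exact: ideal_gen0 | exact: ideal_genD |].
rewrite mcoeff_msupp => /Hp /UX [c [g [Xg ->]]].
by rewrite -mul_mpolyC mulrA; apply: ideal_gen_multiple.
Qed.
End MonomialGenerators.

Section EdgeIdeals.
Variable K : fieldType.

Definition ord_edge (G : sgraph) : rel 'I_#|G| := fun i j => edge (enum_val i) (enum_val j).

Lemma ord_edge_sym G : ssrbool.symmetric (@ord_edge G).
Proof. by move=> i j; rewrite /ord_edge edge_sym. Qed.

Local Notation emulG G := (emul (@ord_edge G) [set: 'I_#|G|]).

Lemma edge_idealP G p : edge_ideal K G p <-> forall u, p@_u != 0 -> emulG G 1 u.
Proof.
apply: ideal_gen_monomial => [|g [a [b [ab ->]]] u|u].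
- exact: emul_up.
- rewrite -mpolyXD mcoeffX; case: (eqVneq _ u) => [<- _|_]; last by rewrite eqxx.
  exists (enum_rank a), (enum_rank b), 0%MM; rewrite !inE addm0; split=> //.
  by rewrite /ord_edge !enum_rankK.
move=> [i [j [v [_ _ ij -> _]]]]; exists 'X_[v], ('X_i * 'X_j); split; last first.
  by rewrite !mpolyXD mulrC.
by exists (enum_val i), (enum_val j); rewrite !enum_valK.
Qed.

Lemma ideal_powP G q p :
  ideal_pow (edge_ideal K G) q p <-> forall u, p@_u != 0 -> emulG G q u.
Proof.
apply: ideal_gen_monomial => [|g [f [Hf ->]]|u].
- exact: emul_up.
- elim: q f Hf => [|q IH] f Hf u //=.
  rewrite big_ord_recl -mcoeff_msupp => /msuppM_le /allpairsP[[u1 u2] /= []].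
  rewrite !mcoeff_msupp => /((edge_idealP _).1 (Hf ord0)) [x [y [v [xA yA xy -> _]]]].
  move=> /(IH _ (fun i => Hf (lift ord0 i))) Hu2 ->.
  exists x, y, (v + u2)%MM; split; rewrite ?addmA //.
  by rewrite addmC; apply: emul_up.
move=> Hu; suff [w [f [Hf ->]]] : exists w (f : 'I_q -> {mpoly K[#|G|]}),
    (forall i, edge_ideal K G (f i)) /\ 'X_[u] = 'X_[w] * \prod_(i < q) f i.
  by exists 'X_[w], (\prod_(i < q) f i); split=> //; exists f.
elim: q u Hu => [|q IH] u /=.
  by exists u, (fun=> 0); split=> [[]|]//; rewrite big_ord0 mulr1.
move=> [x [y [v [_ _ xy -> /IH [w [f [Hf Ev]]]]]]].
exists w, (fun i => if unlift ord0 i is Some j then f j else 'X_x * 'X_y); split.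
  move=> i; case: unliftP => [j _|_]; first exact: Hf.
  rewrite -['X_x * _]mul1r; apply: ideal_gen_multiple.
  by exists (enum_val x), (enum_val y); rewrite !enum_valK.
rewrite !mpolyXD Ev big_ord_recl unlift_none mulrCA; congr (_ * (_ * _)).
by apply: eq_bigr => i _; rewrite liftK.
Qed.

(** For g(A) = |A| + 1 every vertex of A is special. Only finiteness of this bound matters: it makes
    [reg] well defined. *)
Lemma mreg_edges_bound (G : sgraph) q l : uniq l -> l =i 'I_#|G| ->
  @mreg K _ l (emulG G q) (2 * q + #|G|.+1 - 2).
Proof.
move=> ul fl.
have := @mreg_colon_edges K _ l ul fl _ (@ord_edge_sym G) (fun A => #|A|.+1) _ _ _
  [set: 'I_#|G|] q [::] isT.
rewrite cardsT card_ord => H; apply: mreg_ext (H _ _ _) => [u||A x|A [x [y [xA _ _]]]] //.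
- by rewrite /emon big_nil addm0.
- by rewrite ltnS; apply: subset_leq_card; apply: subD1set.
exists x => //; rewrite addn1 ltnS; apply: proper_card.
by apply/properP; split; [apply: subsetDl | exists x; rewrite // !inE eqxx].
Qed.

Lemma nonempty_emul (G : sgraph) q : nonempty G -> exists u, emulG G q u.
Proof.
move=> [a [b ab]]; elim: q => [|q [u Hu]]; first by exists 0%MM.
exists (U_(enum_rank a) + U_(enum_rank b) + u)%MM, (enum_rank a), (enum_rank b), u.
by rewrite !inE /ord_edge !enum_rankK.
Qed.

Lemma reg_edgeless (G : sgraph) : ~ nonempty G -> reg (edge_ideal K G) = 1%N.
Proof.
move=> Gn; rewrite /reg; case: excluded_middle_informative => // -[].
move=> p [m [c [g [Hg ->]]]]; apply: big1 => i _; have [a [b [ab _]]] := Hg i.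
by case: Gn; exists a, b.
Qed.

(** Setting the variables outside G1 to zero retracts the Koszul complex of G2 onto that of G1.
    Those variables are listed first, as [vanish_rename] requires. *)
Lemma reg_embed (G1 G2 : sgraph) (f : G1 -> G2) : injective f ->
  (forall u v, edge (f u) (f v) = edge u v) -> nonempty G1 ->
  (reg (edge_ideal K G1) <= reg (edge_ideal K G2))%N.
Proof.
move=> f_inj f_edge ne1.
have ne2 : nonempty G2 by have [a [b ab]] := ne1; exists (f a), (f b); rewrite f_edge.
pose h (i : 'I_#|G1|) : 'I_#|G2| := enum_rank (f (enum_val i)).
have h_inj : injective h by move=> i j /enum_rank_inj /f_inj /enum_val_inj.
have eu (G : sgraph) : uniq (enum 'I_#|G|) by apply: enum_uniq.
have ef (G : sgraph) : enum 'I_#|G| =i 'I_#|G| by move=> i; rewrite mem_enum.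
pose r := [seq z <- enum 'I_#|G2| | z \notin codom h].
have ul : uniq (r ++ map h (enum 'I_#|G1|)).
  rewrite cat_uniq filter_uniq ?enum_uniq // map_inj_uniq ?enum_uniq // andbT /=.
  apply/hasPn => z /mapP[i _ ->]; rewrite mem_filter negb_and negbK codom_f //.
have fl : r ++ map h (enum 'I_#|G1|) =i 'I_#|G2|.
  move=> z; rewrite mem_cat mem_filter mem_enum andbT.
  by case: (z \in codom h).
have B1 := @mreg_edges_bound G1 1 _ (eu G1) (ef G1).
have B2 := @mreg_edges_bound G2 1 _ (eu G2) (ef G2).
have HR := mreg_reg (eu G2) (ef G2) (@emul_up _ (@ord_edge G2) _ 1) (edge_idealP (G := G2)) B2
  (nonempty_emul 1 ne2) ul fl.
apply: (reg_le_mreg (eu G1) (ef G1) (@emul_up _ (@ord_edge G1) _ 1) (edge_idealP (G := G1)) B1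
  (nonempty_emul 1 ne1)).
apply: (mreg_rename h_inj _ _ HR) => [z|u]; first by rewrite mem_filter => /andP[].
split=> [[x [y [v [_ _ xy -> _]]]]|].
  exists (h x), (h y), (mpush h v); split; rewrite ?inE ?mpushD ?mpushU //.
  by rewrite /ord_edge /h !enum_rankK f_edge.
move=> [x' [y' [w [_ _ xy E _]]]].
have hx z : z = x' \/ z = y' -> exists i, z = h i.
  move=> Hz; have [/codomP[i ->]|zh] := boolP (z \in codom h); first by exists i.
  have := mpush_notin u zh; rewrite E !mnmDE !mnm1E.
  by case: Hz => ->; rewrite eqxx; lia.
have [x Ex] := hx x' (or_introl erefl); have [y Ey] := hx y' (or_intror erefl).
exists x, y, (mpull h w); split; rewrite ?inE //.
  by move: xy; rewrite Ex Ey /ord_edge /h !enum_rankK f_edge.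
rewrite -(mpushK h_inj u) E Ex Ey; apply/mnmP => i.
by rewrite !(mnmE, mnmDE, mnm1E) !(inj_eq h_inj).
Qed.

End EdgeIdeals.

Theorem corollary4p2 (K : fieldType) (G : sgraph)
  (G_nonempty : nonempty G) (G_no_isolated : no_isolated G)
  (G_induced : forall A : {set G}, nonempty (induced A) ->
    exists x : induced A,
      (reg (edge_ideal K (delete (cnbhd x))) + 1
         <= reg (edge_ideal K (induced A)))%N)
  (q : nat) (q_ge1 : (1 <= q)%N) :
  (reg (ideal_pow (edge_ideal K G) q) <= 2 * q + reg (edge_ideal K G) - 2)%N.
Proof.
pose V (A : {set 'I_#|G|}) : {set G} := [set x | enum_rank x \in A].
pose g A := reg (edge_ideal K (induced (V A))).
have g_gt0 A : (0 < g A)%N.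
  (* With an edge present, the hypothesis bounds the regularity below by a successor. *)
  have [/G_induced[x]|/reg_edgeless E] := classic (nonempty (induced (V A))).
    by rewrite addn1; apply: leq_ltn_trans.
  by rewrite /g E.
have g_delete A x : (g (A :\ x) <= g A)%N.
  have [ne|/reg_edgeless E] := classic (nonempty (induced (V (A :\ x)))); last by rewrite {1}/g E.
  have sub (v : induced (V (A :\ x))) : val v \in V A.
    by have := valP v; rewrite !inE => /andP[].
  apply: (@reg_embed K (induced _) (induced (V A)) (fun v => Sub (val v) (sub v)) _ _ ne) => //.
  by move=> v w [/val_inj].
have g_special (A : {set 'I_#|G|}) : (exists x y, [/\ x \in A, y \in A & @ord_edge G x y]) ->
    exists2 x, x \in A & (g (A :\: (x |: [set y | @ord_edge G x y])) + 1 <= g A)%N.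
  move=> [a [b [aA bA ab]]].
  have aV : enum_val a \in V A by rewrite inE enum_valK.
  have bV : enum_val b \in V A by rewrite inE enum_valK.
  have [|x Hx] := G_induced (V A).
    by exists (Sub (enum_val a) aV), (Sub (enum_val b) bV).
  exists (enum_rank (val x)); first by have := valP x; rewrite inE.
  apply: leq_trans Hx; rewrite leq_add2r.
  set B := A :\: _.
  have subA (w : induced (V B)) : val w \in V A by have := valP w; rewrite !inE => /andP[].
  have subN (w : induced (V B)) : (Sub (val w) (subA w) : induced (V A)) \in ~: cnbhd x.
    have := valP w; rewrite !inE /ord_edge !enum_rankK => /andP[].
    by rewrite (inj_eq enum_rank_inj) -val_eqE.
  (* Both graphs are H \ N[x], built over different vertex types. [reg_embed] compares them but
     needs an edge; without one, both regularities are 1. *)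
  have [ne|none] := classic (nonempty (induced (V B))).
    apply: (@reg_embed K (induced _) (delete (cnbhd x))
      (fun w => Sub (Sub (val w) (subA w)) (subN w)) _ _ ne) => //.
    by move=> v w [/val_inj].
  rewrite {1}/g (reg_edgeless K none) reg_edgeless // => -[u [v uv]].
  have inB (w : delete (cnbhd x)) : val (val w) \in V B.
    have := valP w; have := valP (val w); rewrite !inE /ord_edge !enum_rankK.
    by rewrite (inj_eq enum_rank_inj) -val_eqE => -> /= ->.
  by apply: none; exists (Sub (val (val u)) (inB u)), (Sub (val (val v)) (inB v)).
have ul : uniq (enum 'I_#|G|) by apply: enum_uniq.
have fl : enum 'I_#|G| =i 'I_#|G| by move=> i; rewrite mem_enum.
have H := @mreg_colon_edges K _ _ ul fl _ (@ord_edge_sym G) g g_gt0 g_delete g_special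
  [set: 'I_#|G|] q [::] isT.
have {}H : @mreg K _ (enum 'I_#|G|) (emul (@ord_edge G) [set: 'I_#|G|] q) (2 * q + g setT - 2).
  by apply: mreg_ext H => u; rewrite /emon big_nil addm0.
(* [H] serves twice: as the finite bound that makes [reg] of the power meaningful, and as the
   estimate itself. *)
apply: leq_trans (reg_le_mreg ul fl (@emul_up _ (@ord_edge G) _ q) (ideal_powP (G := G) q) H
  (nonempty_emul q G_nonempty) H) _.
apply: leq_sub2r; rewrite leq_add2l.
apply: (@reg_embed K (induced (V setT)) G val) => //; first exact: val_inj.
have [a [b ab]] := G_nonempty.
have inV x : x \in V setT by rewrite !inE.
by exists (Sub a (inV a)), (Sub b (inV b)).
Qed.
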